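(* If $u$ is a strong solution of $\partial_tu=\tfrac12u\,\partial_x^2u$, $u(0,\cdot)=u_0$, on $[0,T)$, then for all $t\in[0,T)$, $$\{x\in\mathbb{R}: u(t,x)=0\}=\{x\in\mathbb{R}:u_0(x)=0\}.$$
   Context: Write $\langle x\rangle=(x^2+1)^{1/2}$; $\langle x\rangle^{\ell}L^\infty$ denotes the space of functions $f$ with $\langle x\rangle^{-\ell}f\in L^\infty$. Consider the equation $\partial_t u=\tfrac12 u\,\partial_x^2u$, $u(0,\cdot)=u_0$, for $(t,x)\in[0,\infty)\times\mathbb{R}$. Weak solution: given $T>0$, $u\in C([0,T);W^{1,\infty}_{\mathrm{loc}}(\mathbb{R}))$ is a weak solution on $[0,T)$ if $u\ge0$ and for all $\psi\in C_c^\infty([0,T)\times\mathbb{R})$, $$\int_{\mathbb{R}}u_0\,\psi(0,\cdot)+\int_{[0,T)\times\mathbb{R}}\Big[u\,\partial_t\psi-\tfrac12\,\partial_x(\psi u)\,\partial_xu\Big]=0 .$$ Strong solution: given $\bar T>0$, a weak solution $u$ on $[0,\bar T)$ is a strong solution on $[0,\bar T)$ if for all $T\in(0,\bar T)$ we have $u\in\langle x\rangle^2L^\infty([0,T]\times\mathbb{R})$ and $\partial_x^2u\in L^1([0,T];L^\infty(\mathbb{R}))$. *)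

(* Defs.v *)
From HB Require Import structures.
From mathcomp Require Import all_boot all_order all_algebra.
From mathcomp Require Import all_classical all_reals all_analysis.

Set Implicit Arguments.
Unset Strict Implicit.
Unset Printing Implicit Defensive.

Import Order.TTheory GRing.Theory Num.Theory.
Import numFieldNormedType.Exports.

Local Open Scope classical_set_scope.
Local Open Scope ring_scope.

Section test_functions.
Context {R : realType} {V : normedModType R}.

(* All iterated directional derivatives of order at most n exist and are
   continuous; for finite-dimensional V this is the class C^n. *)
Fixpoint Ck (n : nat) (f : V -> R) : Prop :=
  continuous f /\
  match n with
  | 0 => True
  | m.+1 => forall v : V, (forall x, derivable f x v) /\ Ck m ('D_v f)
  end.

Definition smooth (f : V -> R) : Prop := forall n, Ck n f.

Definition supp (f : V -> R) : set V := closure [set x | f x != 0].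

Definition test_function (O : set V) (f : V -> R) : Prop :=
  [/\ smooth f, compact (supp f) & supp f `<=` O].

End test_functions.

Section Linfty_spaces.
Context {d : measure_display} {X : measurableType d} {R : realType}.
Variable m : {measure set X -> \bar R}.

Definition Linfty_norm (D : set X) (f : X -> R) : \bar R :=
  ('N[m]_+oo[EFin \o (f \_ D)])%E.

Definition Linfty (D : set X) (f : X -> R) : Prop :=
  measurable_fun D f /\ (Linfty_norm D f < +oo)%E.

End Linfty_spaces.

Section equation.
Context {R : realType}.

Local Notation mu := (@lebesgue_measure R).
Local Notation mu2 := (mu \x mu)%E.

Definition bracket (x : R) : R := Num.sqrt (x ^+ 2 + 1).

(* g is the k-th derivative of f in the sense of distributions on R. *)
Definition weak_derivative (k : nat) (f g : R -> R) : Prop :=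
  [/\ locally_integrable [set: R] f, locally_integrable [set: R] g &
      forall phi : R -> R, test_function [set: R] phi ->
        \int[mu]_x (f x * derive1n k phi x) = (-1) ^+ k * \int[mu]_x (g x * phi x)].

(* w is a jointly measurable version of the k-th weak x-derivative of
   (t, x) |-> v t x on I x R. *)
Definition is_dx (k : nat) (I : set R) (v w : R -> R -> R) : Prop :=
  measurable_fun (I `*` [set: R]) (fun z : R * R => w z.1 z.2) /\
  {ae mu, forall t, I t -> weak_derivative k (v t) (w t)}.

(* f belongs to W^{1,oo}_loc(R), with weak derivative g. *)
Definition W1oo_loc (f g : R -> R) : Prop :=
  weak_derivative 1 f g /\
  forall M : R, Linfty mu `[- M, M] f /\ Linfty mu `[- M, M] g.

(* The W^{1,oo}(-M, M) norm of f when g is the weak derivative of f. *)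
Definition W1oo_norm (M : R) (f g : R -> R) : \bar R :=
  (Linfty_norm mu `[(- M)%R, M] f + Linfty_norm mu `[(- M)%R, M] g)%E.

(* u belongs to C([0, T); W^{1,oo}_loc(R)), with ux a jointly measurable version
   of its weak x-derivative.  Each class u(t) in W^{1,oo}_loc(R) is represented
   by its continuous representative, so that pointwise values make sense. *)
Definition C_W1oo_loc (T : R) (u ux : R -> R -> R) : Prop :=
  [/\ measurable_fun (`[0, T[ `*` [set: R]) (fun z : R * R => ux z.1 z.2),
      forall t, 0 <= t < T -> continuous (u t) /\ W1oo_loc (u t) (ux t) &
      forall s M, 0 <= s < T ->
        (fun t => W1oo_norm M (u t \- u s) (ux t \- ux s))
          @ within `[0, T[ (nbhs s) --> 0%E].

(* C_c^oo([0, T) x R) consists of the restrictions to [0, T) x R of the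
   functions in C_c^oo((-oo, T) x R).  The function w stands for d_x(psi u);
   it exists, and it is unique up to a null set. *)
Definition weak_solution (T : R) (u0 : R -> R) (u : R -> R -> R) : Prop :=
  exists ux : R -> R -> R,
    [/\ C_W1oo_loc T u ux,
        forall t x, 0 <= t < T -> 0 <= u t x &
        forall (psi : R * R -> R) (w : R -> R -> R),
          test_function [set z | z.1 < T] psi ->
          is_dx 1 `[0, T[ (fun t x => psi (t, x) * u t x) w ->
          \int[mu]_x (u0 x * psi (0, x)) +
          \int[mu2]_(z in `[0, T[ `*` [set: R])
            (u z.1 z.2 * 'D_(1, 0) psi z - 2^-1 * w z.1 z.2 * ux z.1 z.2) = 0].

Definition strong_solution (Tbar : R) (u0 : R -> R) (u : R -> R -> R) : Prop :=
  weak_solution Tbar u0 u /\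
  forall T, 0 < T < Tbar ->
    Linfty mu2 (`[0, T] `*` [set: R])
      (fun z : R * R => bracket z.2 ^- 2 * u z.1 z.2) /\
    exists uxx : R -> R -> R,
      is_dx 2 `[0, T] u uxx /\
      (\int[mu]_(t in `[0%R, T]) Linfty_norm mu [set: R] (uxx t) < +oo)%E.

End equation.

(* Main.v *)
(* Testing the equation against theta(t) phi(x) with phi >= 0 shows that the
   moment m(t) = \int u(t, x) phi(x) dx satisfies m(t) = \int u0 phi + \int_0^t B
   with B = - 1/2 \int (phi u)_x u_x.  Since u_xx(t) is bounded for almost every
   t, an integration by parts gives B = 1/2 \int phi u u_xx, and u >= 0 yields
   |B(t)| <= 1/2 ||u_xx(t)||_oo m(t).  As ||u_xx||_oo is integrable in time,
   Gronwall's argument bounds m(t) by C m(0) and m(0) by C m(t), where C does not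
   depend on phi.  Letting phi concentrate at a point gives u(t, .) <= C u0 and
   u0 <= C u(t, .) pointwise, so that the zero sets coincide. *)

Require Import Defs.
From mathcomp Require Import all_boot all_order all_algebra.
From mathcomp Require Import all_classical all_reals all_analysis.
From mathcomp Require Import measurable_realfun ess_sup_inf.
From mathcomp Require Import ring lra.
Import Order.TTheory GRing.Theory Num.Theory.
Import numFieldNormedType.Exports.

Set Implicit Arguments.
Unset Strict Implicit.
Unset Printing Implicit Defensive.

Local Open Scope classical_set_scope.
Local Open Scope ring_scope.

(** * Smooth functions *)

(** The weak formulation sees only space-time integrals, so the identity for m is not immediate.
    Test functions theta that vanish at time 0 say that B is the weak derivative of m; a du
    Bois-Reymond argument gives m = c + \int_0^t B for almost every t, continuity of u in time
    removes the exceptional set, and a theta with theta(0) > 0 identifies c with \int u0 phi. The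
    same primitives, combined with Fubini on a triangle, give the integration by parts in space,
    where the weak derivatives are merely integrable. The growth rate, half of ||u_xx||_oo, is only
    integrable in time. Instead of an exponential bound, an interval [0, b] with t <= b < T is cut
    into equal pieces, on each of which the rate has integral at most 1/2; there m changes by at
    most a factor 2 in either direction of time. So C is a power of 2 determined by the rate and b
    alone. Joint measurability of u, required by Fubini, is read off from the weighted L^oo bound of
    a strong solution. *)

Section smooth_functions.
Context {R : realType} {V : normedModType R}.
Implicit Types (f g : V -> R) (n : nat).

(** [smooth] is the largest class of continuous functions stable under directional derivation, so
    smoothness follows by exhibiting one stable class, without induction on the order. *)
Lemma smooth_coind (S : set (V -> R)) :
  (forall f, S f -> continuous f /\
     forall v, (forall x, derivable f x v) /\ S ('D_v f)) ->
  S `<=` smooth.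
Proof.
move=> HS f Sf n; elim: n f Sf => [|n IH] f Sf /=; first by split => //; have [] := HS _ Sf.
have [cf df] := HS _ Sf; split => // v; have [d1 d2] := df v; split => //.
exact: IH.
Qed.

Lemma smooth_continuous f : smooth f -> continuous f.
Proof. by move=> /(_ 0%N)[]. Qed.

Lemma smooth_derivable f x v : smooth f -> derivable f x v.
Proof. by move=> /(_ 1%N)[_ /(_ v)[]]. Qed.

Lemma smooth_derive f v : smooth f -> smooth ('D_v f).
Proof. by move=> sf n; have [_ /(_ v)[]] := sf n.+1. Qed.

Lemma CkS n f : Ck n.+1 f -> Ck n f.
Proof.
elim: n f => [|n IH] f [cf df]; first by split.
by split => // v; have [d1 d2] := df v; split => //; exact: IH.
Qed.

Lemma CkD n f g : Ck n f -> Ck n g -> Ck n (f + g).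
Proof.
elim: n f g => [|n IH] f g [cf df] [cg dg].
  by split => // x; apply: continuousD; [exact: cf|exact: cg].
split => [x|v]; first by apply: continuousD; [exact: cf|exact: cg].
have [df1 df2] := df v; have [dg1 dg2] := dg v; split.
  by move=> x; apply: derivableD.
rewrite (_ : 'D_v (f + g) = 'D_v f + 'D_v g); first exact: IH.
by apply/funext => x; rewrite deriveD.
Qed.

Lemma CkM n f g : Ck n f -> Ck n g -> Ck n (f * g).
Proof.
elim: n f g => [|n IH] f g Hf Hg.
  by split => // x; apply: continuousM; [exact: (proj1 Hf)|exact: (proj1 Hg)].
have [cf df] := Hf; have [cg dg] := Hg.
split => [x|v]; first by apply: continuousM; [exact: cf|exact: cg].
have [df1 df2] := df v; have [dg1 dg2] := dg v; split.
  by move=> x; apply: derivableM.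
rewrite (_ : 'D_v (f * g) = f * 'D_v g + g * 'D_v f).
  by apply: CkD; apply: IH => //; exact: CkS.
by apply/funext => x; rewrite deriveM.
Qed.

Lemma smoothD f g : smooth f -> smooth g -> smooth (f + g).
Proof. by move=> sf sg n; exact: CkD. Qed.

Lemma smoothM f g : smooth f -> smooth g -> smooth (f * g).
Proof. by move=> sf sg n; exact: CkM. Qed.

Lemma smooth_cst (k : R) : smooth (cst k : V -> R).
Proof.
apply: (@smooth_coind (range (fun k : R => cst k))); last by exists k.
move=> _ [c _ <-]; split => [x|v]; first exact: cvg_cst.
split => [x|]; first exact: derivable_cst.
by exists 0 => //; apply/funext => x; rewrite derive_cst.
Qed.

End smooth_functions.

Section smooth_comp_affine.
Context {R : realType} {V : normedModType R}.

Lemma derive_comp_affine (g : R -> R) (L l : V -> R) (v x : V) :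
  (forall h x, L (h *: v + x) = h * l v + L x) ->
  'D_v (g \o L) x = 'D_(l v) g (L x).
Proof. by move=> HL; rewrite /derive; under eq_fun do rewrite /= HL. Qed.

(** Here [l] is the linear part of the affine map [L], and the functions [g \o L] with [g] smooth
    form a stable class. The uses are affine changes of variable on the line and the two coordinates
    of the plane. *)
Lemma smooth_comp_affine (g : R -> R) (L l : V -> R) :
  (forall h v x, L (h *: v + x) = h * l v + L x) -> continuous L ->
  smooth g -> smooth (g \o L).
Proof.
move=> HL cL sg; apply: (smooth_coind (S := [set g \o L | g in smooth])); last by exists g.
move=> _ [f sf <-]; split => [x|v].
  by apply: continuous_comp; [exact: cL|exact: smooth_continuous].
split => [x|].
  rewrite /derivable; under eq_fun do rewrite /= HL.
  exact: (@smooth_derivable _ _ f (L x) (l v) sf).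
exists ('D_(l v) f); first exact: smooth_derive.
by apply/funext => x; rewrite (@derive_comp_affine f L l) // => h y; exact: HL.
Qed.

End smooth_comp_affine.

Section smooth_real.
Context {R : realType}.
Implicit Types f g : R -> R.

Lemma deriveZr f (v x : R) : derivable f x 1 ->
  derivable f x v /\ 'D_v f x = v * derive1 f x.
Proof.
move=> df; have dd : differentiable f x by exact/derivable1_diffP.
split; first exact: diff_derivable.
by rewrite deriveE// deriv1E// /=.
Qed.

Lemma is_derive_continuous f (x d : R) : is_derive x 1 f d -> {for x, continuous f}.
Proof. by case=> df _; apply: differentiable_continuous; exact/derivable1_diffP. Qed.

Lemma smooth_derive1 f : smooth f -> smooth (derive1 f).
Proof.
move=> sf; rewrite (_ : derive1 f = 'D_1 f); first exact: smooth_derive.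
by apply/funext => x; rewrite derive1E.
Qed.

(** On the line the derivative in direction [v] is [v] times the ordinary one, so closure under
    scalar multiples replaces the quantification over directions. *)
Lemma smooth_coind1 (S : set (R -> R)) :
  (forall k f, S f -> S (k \*o f)) ->
  (forall f, S f -> exists2 g, S g & forall x : R, is_derive x 1 f (g x)) ->
  S `<=` smooth.
Proof.
move=> SZ Sd; apply: smooth_coind => f /Sd[g Sg fg]; split => [x|v].
  exact: is_derive_continuous (fg x).
have dfv x : derivable f x v /\ 'D_v f x = v * derive1 f x by exact: deriveZr.
split => [x|]; first by have [] := dfv x.
rewrite (_ : 'D_v f = v \*o g); first exact: SZ.
apply/funext => x; have [_ ->] := dfv x.
by rewrite derive1E derive_val /= mulrC.
Qed.

Lemma smooth_primitive f g : (forall x : R, is_derive x 1 f (g x)) -> smooth g -> smooth f.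
Proof.
move=> fg sg n; have cf : continuous f.
  by move=> x; exact: is_derive_continuous (fg x).
case: n => [|n]; split => // v.
have dfv x : derivable f x v /\ 'D_v f x = v * derive1 f x by exact: deriveZr.
split => [x|]; first by have [] := dfv x.
rewrite (_ : 'D_v f = (cst v * g)); first by apply: CkM; [exact: smooth_cst|].
apply/funext => x; have [_ ->] := dfv x.
by rewrite derive1E derive_val.
Qed.

End smooth_real.

(** * Smooth cutoffs *)

Section cutoff.
Context {R : realType}.
Implicit Types (p : {poly R}) (x y : R).

(** y^n exp(-y) is at most n!, since exp(y) dominates the term y^n/n! of its series. With y = 1/x
    this beats any pole at 0. *)
Lemma poly_expR_bound p : exists C, forall y, 0 <= y -> `|p.[y]| * expR (- y) <= C.
Proof.
have mono n y : 0 <= y -> y ^+ n * expR (- y) <= n`!%:R.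
  move=> y0; rewrite expRN ler_pdivrMr ?expR_gt0//.
  case: n => [|n].
    by rewrite expr0 fact0 mul1r -expR0 ler_expR.
  rewrite mulrC -ler_pdivrMr ?ltr0n ?fact_gt0//.
  by apply: le_trans (expR_ge1Dxn n y0); rewrite lerDr.
exists (\sum_(i < size p) `|p`_i| * i`!%:R) => y y0.
rewrite horner_coef.
apply: (@le_trans _ _ ((\sum_(i < size p) `|p`_i| * y ^+ i) * expR (- y))).
  rewrite ler_wpM2r ?expR_ge0//; apply: le_trans (ler_norm_sum _ _ _) _.
  by apply: ler_sum => i _; rewrite normrM (ger0_norm (exprn_ge0 _ _)).
rewrite mulr_suml; apply: ler_sum => i _.
by rewrite -mulrA ler_wpM2l// mono.
Qed.

(* This class of functions is stable under derivation, at 0 too, which makes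
   exp(-1/x) smooth. *)
Definition flat_exp p x : R := if 0 < x then p.[x^-1] * expR (- x^-1) else 0.

Lemma is_derive_quadratic (f : R -> R) (C : R) :
  (forall x, `|f x| <= C * x ^+ 2) -> is_derive (0 : R) 1 f 0.
Proof.
move=> fC; have f0 : f 0 = 0.
  by apply/normr0_eq0/eqP; rewrite eq_le normr_ge0 andbT; have := fC 0; rewrite expr0n mulr0.
have C0 : 0 <= C by have := le_trans (normr_ge0 _) (fC 1); rewrite expr1n mulr1.
suff H : h^-1 *: ((f \o shift 0) (h *: 1) - f 0) @[h --> 0^'] --> (0 : R).
  by split; [apply/cvg_ex; exists 0|exact: cvg_lim].
apply/cvgr0Pnorm_le => e e0; near=> h.
rewrite /= addr0 f0 subr0 normrM /GRing.scale /= mulr1 normfV.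
have h0 : 0 < `|h| by rewrite normr_gt0; near: h; exact: nbhs_dnbhs_neq.
rewrite mulrC ler_pdivrMr//; apply: le_trans (fC _) _.
rewrite -real_normK ?num_real// expr2 mulrA ler_wpM2r//.
(* The constant [C] may be 0, hence the denominator [C + 1]. *)
have : `|h| <= e / (C + 1) by near: h; apply: dnbhs0_le; rewrite divr_gt0// ltr_wpDl.
rewrite ler_pdivlMr ?ltr_wpDl//; apply: le_trans.
by rewrite mulrC ler_wpM2l// lerDl.
Unshelve. all: by end_near. Qed.

(** For x > 0 put y = 1/x: the derivative of p(y) exp(-y) is y^2 (p(y) - p'(y)) exp(-y), again of
    the same form. At 0, the polynomial bound applied to X^2 p shows that the function is O(x^2), so
    its derivative there is 0. *)
Lemma is_derive_flat_exp p x :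
  is_derive x 1 (flat_exp p) (flat_exp ('X ^+ 2 * (p - p^`())) x).
Proof.
rewrite /flat_exp; have [x0|x0|<-] := ltgtP 0 x.
- apply: (@near_eq_is_derive _ _ _ (fun x => p.[x^-1] * expR (- x^-1))).
    by apply: filterS (lt_nbhsr x0) => z z0; rewrite z0.
  have dV : is_derive x 1 (fun x : R => x^-1) (- x ^- 2).
    apply: is_derive_eq; first by apply: is_deriveV; rewrite gt_eqF.
    by rewrite scaler1.
  have dp : is_derive x 1 (fun x : R => p.[x^-1]) (p^`().[x^-1] * - x ^- 2).
    exact: (@is_derive1_comp _ (horner p)).
  have de : is_derive x 1 (fun x : R => expR (- x^-1)) (x ^- 2 * expR (- x^-1)).
    have dN : is_derive x 1 (fun x : R => - x^-1) (x ^- 2).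
      by apply: is_derive_eq; rewrite opprK.
    by rewrite mulrC; exact: (@is_derive1_comp _ expR).
  apply: is_derive_eq (is_deriveM dp de) _.
  rewrite /GRing.scale /= hornerM hornerXn hornerD hornerN exprVn; ring.
- apply: (@near_eq_is_derive _ _ _ (cst 0)).
    by apply: filterS (lt_nbhsl x0) => z z0; rewrite ltNge (ltW z0).
have [C HC] := poly_expR_bound ('X ^+ 2 * p).
have fC z : `|flat_exp p z| <= C * z ^+ 2.
  have C0' : 0 <= C by apply: le_trans (HC 0 (lexx _)); rewrite mulr_ge0 ?expR_ge0.
  rewrite /flat_exp; case: ifPn => z0; last first.
    by rewrite normr0 mulr_ge0// sqr_ge0.
  have := HC z^-1; rewrite invr_ge0 ltW// => /(_ isT).
  rewrite hornerM hornerXn normrM normrX normfV (gtr0_norm z0).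
  rewrite exprVn => H; rewrite normrM (ger0_norm (expR_ge0 _)) -ler_pdivrMr ?exprn_gt0//.
  by apply: le_trans H; rewrite mulrC mulrA.
apply: is_derive_quadratic => z; exact: fC.
Qed.


Lemma smooth_flat_exp p : smooth (flat_exp p).
Proof.
apply: (smooth_coind1 (S := range flat_exp)); last by exists p.
- move=> k _ [q _ <-]; exists (k *: q) => //; apply/funext => x.
  by rewrite /flat_exp /=; case: ifP => _; rewrite ?mulr0// hornerZ mulrA.
- move=> _ [q _ <-]; exists (flat_exp ('X ^+ 2 * (q - q^`()))); first by exists ('X ^+ 2 * (q - q^`())).
  by move=> x; exact: is_derive_flat_exp.
Qed.

(** A bump positive exactly on ]a, b[ when k > 0. The steepness k drives it to the indicator of that
    interval, with values kept in [0, 1]. *)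
Definition cutoff (a b k x : R) : R :=
  flat_exp 1 (k * (x - a)) * flat_exp 1 (k * (b - x)).

Lemma flat_exp1_ge0 x : 0 <= flat_exp 1 x.
Proof. by rewrite /flat_exp; case: ifP => // _; rewrite hornerC mul1r expR_ge0. Qed.

Lemma flat_exp1_le1 x : flat_exp 1 x <= 1.
Proof.
rewrite /flat_exp; case: ifP => // x0; rewrite hornerC mul1r -expR0 ler_expR.
by rewrite oppr_le0 invr_ge0 ltW.
Qed.

Lemma cutoff_ge0 a b k x : 0 <= cutoff a b k x.
Proof. by rewrite mulr_ge0// flat_exp1_ge0. Qed.

Lemma cutoff_le1 a b k x : cutoff a b k x <= 1.
Proof. by rewrite mulr_ile1// ?flat_exp1_ge0 ?flat_exp1_le1. Qed.

Lemma cutoff_gt0 a b k x : 0 < k -> a < x < b -> 0 < cutoff a b k x.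
Proof.
move=> k0 /andP[ax xb]; have flat_gt0 y : 0 < y -> 0 < flat_exp 1 y.
  by move=> y0; rewrite /flat_exp y0 hornerC mul1r expR_gt0.
by rewrite /cutoff mulr_gt0 ?flat_gt0// mulr_gt0// subr_gt0.
Qed.

Lemma cutoff_eq0 a b k x : 0 < k -> ~~ (a < x < b) -> cutoff a b k x = 0.
Proof.
move=> k0; rewrite negb_and => /orP[] H; rewrite /cutoff /flat_exp.
  by rewrite ifF ?mul0r// pmulr_rgt0// subr_gt0; exact/negbTE.
by rewrite mulrC ifF ?mul0r// pmulr_rgt0// subr_gt0; exact/negbTE.
Qed.

Lemma smooth_cutoff a b k : smooth (cutoff a b k).
Proof.
have H c : smooth (flat_exp 1 \o (fun x => k * (x - c))).
  apply: (smooth_comp_affine (l := fun v => k * v)); last exact: smooth_flat_exp.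
    by move=> h v x; rewrite /GRing.scale/=; ring.
  by move=> x; apply: cvgM; [exact: cvg_cst|apply: cvgB; [exact: cvg_id|exact: cvg_cst]].
have H' : smooth (flat_exp 1 \o (fun x => k * (b - x))).
  apply: (smooth_comp_affine (l := fun v => - k * v)); last exact: smooth_flat_exp.
    by move=> h v x; rewrite /GRing.scale/=; ring.
  by move=> x; apply: cvgM; [exact: cvg_cst|apply: cvgB; [exact: cvg_cst|exact: cvg_id]].
exact: smoothM (H a) H'.
Qed.

Lemma cutoff_cvg a b x : cutoff a b n.+1%:R x @[n --> \oo] --> (\1_`]a, b[ x : R).
Proof.
have flat_cvg y : flat_exp 1 (n.+1%:R * y) @[n --> \oo] --> ((0 < y)%R%:R : R).
  have [y0|y0] := ltP 0 y; last first.
    rewrite (_ : (fun n => _) = cst 0); first exact: cvg_cst.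
    apply/funext => n; rewrite /flat_exp ifF//.
    by apply/negbTE; rewrite -leNgt mulr_ge0_le0.
  rewrite (_ : (fun n => _) = (fun n => expR (- (n.+1%:R^-1 * y^-1)))); last first.
    by apply/funext => n; rewrite /flat_exp pmulr_rgt0// y0 hornerC mul1r invfM.
  suff: expR (- (n.+1%:R^-1 * y^-1)) @[n --> \oo] --> expR (- (0 * y^-1)).
    by rewrite mul0r oppr0 expR0.
  apply: continuous_cvg; first exact: continuous_expR.
  by apply: cvgN; apply: cvgM; [exact: cvg_harmonic|exact: cvg_cst].
rewrite indicE mem_setE in_itv /= -mulnb natrM -[a < x]subr_gt0 -[x < b]subr_gt0.
by apply: cvgM; exact: flat_cvg.
Qed.

End cutoff.

(** * Integration almost everywhere *)

Section integration.
Context {d} {T : measurableType d} {R : realType} (m : {measure set T -> \bar R}).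
Implicit Types (D : set T) (f g : T -> R).

Lemma ae_imp (P Q : T -> Prop) : (forall x, P x -> Q x) ->
  {ae m, forall x, P x} -> {ae m, forall x, Q x}.
Proof. by move=> PQ; exact: filterS. Qed.

Lemma ae_and (P Q : T -> Prop) : {ae m, forall x, P x} -> {ae m, forall x, Q x} ->
  {ae m, forall x, P x /\ Q x}.
Proof. by move=> aP aQ; near=> x; split; near: x. Unshelve. all: by end_near. Qed.

Lemma ae_le_integrable D f g : measurable D -> measurable_fun D f ->
  {ae m, forall x, D x -> `|f x| <= g x} ->
  m.-integrable D (EFin \o g) -> m.-integrable D (EFin \o f).
Proof.
move=> mD mf fg /integrableP[mg goo]; apply/integrableP; split; first exact/measurable_EFinP.
apply: le_lt_trans goo; apply: ae_ge0_le_integral => //.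
- by apply: measurableT_comp => //; exact/measurable_EFinP.
- exact: measurableT_comp.
- by apply: filterS fg => x fg Dx; rewrite lee_fin (le_trans (fg Dx))// ler_norm.
Qed.

Lemma ae_bounded_integrable D f (K : R) : measurable D -> (m D < +oo)%E ->
  measurable_fun D f -> {ae m, forall x, D x -> `|f x| <= K} ->
  m.-integrable D (EFin \o f).
Proof.
move=> mD Dfin mf fK; apply: ae_le_integrable (cst K) _ _ _ _ => //.
apply: measurable_bounded_integrable => //.
by exists `|K|; split; [exact: num_real|move=> y yK x _ /=; exact: ltW].
Qed.

Lemma ae_le_Rintegral D f g : measurable D ->
  m.-integrable D (EFin \o f) -> m.-integrable D (EFin \o g) ->
  {ae m, forall x, D x -> f x <= g x} ->
  \int[m]_(x in D) f x <= \int[m]_(x in D) g x.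
Proof.
move=> mD fi gi fg; rewrite -subr_ge0 -RintegralB//.
have mgf : measurable_fun D (fun x => g x - f x).
  by apply: measurable_funB; apply/measurable_EFinP; [exact: measurable_int gi|exact: measurable_int fi].
(* As g - f is nonnegative only almost everywhere, it is replaced by its absolute value, which is
   nonnegative at every point. *)
rewrite /Rintegral (@ae_eq_integral _ _ _ _ _ (fun x => `|g x - f x|%:E))//.
- by rewrite fine_ge0// integral_ge0// => x _; rewrite lee_fin.
- exact/measurable_EFinP.
- by apply/measurable_EFinP; exact: measurableT_comp.
- by apply: filterS fg => x fg Dx; rewrite /= ger0_norm// subr_ge0 fg.
Qed.

Lemma ae_eq_Rintegral D f g : measurable D ->
  measurable_fun D f -> measurable_fun D g ->
  {ae m, forall x, D x -> f x = g x} ->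
  \int[m]_(x in D) f x = \int[m]_(x in D) g x.
Proof.
move=> mD mf mg fg; congr fine; apply: ae_eq_integral => //; try exact/measurable_EFinP.
by apply: filterS fg => x fg Dx; rewrite fg.
Qed.

Lemma Rintegral_restrict D D' f : D' `<=` D -> (forall x, D x -> ~ D' x -> f x = 0) ->
  \int[m]_(x in D) f x = \int[m]_(x in D') f x.
Proof.
move=> DD f0; rewrite Rintegral_mkcond [RHS]Rintegral_mkcond; apply: eq_Rintegral => x _.
rewrite /patch; case: ifPn => xD; case: ifPn => xD' //.
  by apply: f0; [rewrite inE in xD|move=> D'x; rewrite mem_set in xD'].
by rewrite inE in xD'; move/DD : xD' => Dx; rewrite mem_set in xD.
Qed.

Lemma integrable_normr D f : m.-integrable D (EFin \o f) ->
  m.-integrable D (EFin \o (fun x => `|f x|)).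
Proof. exact: integrable_norm. Qed.

Lemma integrable_Mbound D f g (K : R) : measurable D ->
  m.-integrable D (EFin \o f) -> measurable_fun D g ->
  {ae m, forall x, D x -> `|g x| <= K} ->
  m.-integrable D (EFin \o (fun x => f x * g x)).
Proof.
move=> mD fi mg gK; apply: (@ae_le_integrable _ _ (fun x => K * `|f x|)) => //.
- by apply: measurable_funM => //; apply/measurable_EFinP; exact: measurable_int fi.
- by apply: filterS gK => x gK Dx; rewrite normrM mulrC ler_wpM2r// gK.
- exact: (@integrableZl _ _ _ m D mD K _ (integrable_normr fi)).
Qed.

End integration.

Section fubini_by_parts.
Context {R : realType}.
Local Notation mu := (@lebesgue_measure R).

(* Fubini on the triangle y <= x. *)
Lemma Rintegral_triangle (a b : R) (f g : R -> R) :
  mu.-integrable `[a, b] (EFin \o f) -> mu.-integrable `[a, b] (EFin \o g) ->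
  \int[mu]_(x in `[a, b]) (f x * \int[mu]_(y in `[a, x]) g y) =
  \int[mu]_(y in `[a, b]) (g y * \int[mu]_(x in `[y, b]) f x).
Proof.
move=> fi gi.
pose fa := f \_ `[a, b]; pose ga := g \_ `[a, b].
have fai : mu.-integrable setT (EFin \o fa).
  by rewrite /fa -restrict_EFin; apply/integrable_restrict => //; rewrite setTI.
have gai : mu.-integrable setT (EFin \o ga).
  by rewrite /ga -restrict_EFin; apply/integrable_restrict => //; rewrite setTI.
have mfa : measurable_fun setT fa by apply/measurable_EFinP; exact: measurable_int fai.
have mga : measurable_fun setT ga by apply/measurable_EFinP; exact: measurable_int gai.
pose h (z : R * R) := if z.2 <= z.1 then fa z.1 * ga z.2 else 0.
have mh : measurable_fun setT h.
  apply: measurable_fun_ifT => //.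
  - by apply: measurable_fun_ler; [exact: measurable_snd|exact: measurable_fst].
  - by apply: measurable_funM; [apply: (measurableT_comp mfa)|apply: (measurableT_comp mga)].
have h1 x : (\int[mu]_y (h (x, y))%:E = (fa x * \int[mu]_(y in `[a, x]) g y)%:E)%E.
  have -> : (fun y => (h (x, y))%:E) = (fun y => ((fa x)%:E * ((EFin \o g) \_ `[a, x]) y)%E).
    apply/funext => y; rewrite /h /fa /ga /=.
    rewrite !patchE !mem_setE !in_itv /=; case: (leP y x) => yx; last by rewrite andbF mule0.
    case: ifPn => /andP; rewrite ?mul0r ?mul0e// => -[ax xb].
    by rewrite (le_trans yx xb) !andbT; case: ifP => // _; rewrite mulr0 mule0.
  have [xab|xab] := boolP (x \in `[a, b]); last first.
    rewrite /fa patchE mem_setE (negbTE xab) mul0r.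
    by under eq_integral do rewrite mul0e; rewrite integral0.
  have gix : mu.-integrable `[a, x] (EFin \o g).
    apply: integrableS gi => //; apply: subset_itvl; rewrite bnd_simp.
    by move: xab; rewrite in_itv => /andP[].
  rewrite integralZl//; last by apply/integrable_restrict => //; rewrite setTI.
  by rewrite -integral_mkcond EFinM fineK// integrable_fin_num.
have h2 y : (\int[mu]_x (h (x, y))%:E = (ga y * \int[mu]_(x in `[y, b]) f x)%:E)%E.
  have -> : (fun x => (h (x, y))%:E) = (fun x => ((ga y)%:E * ((EFin \o f) \_ `[y, b]) x)%E).
    apply/funext => x; rewrite /h /fa /ga /= mulrC.
    rewrite !patchE !mem_setE !in_itv /=; case: (leP y x) => yx; last by rewrite mule0.
    case: ifPn => /andP; rewrite ?mul0r ?mul0e// => -[ay yb].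
    by rewrite (le_trans ay yx) /=; case: ifP => // _; rewrite mulr0 mule0.
  have [yab|yab] := boolP (y \in `[a, b]); last first.
    rewrite /ga patchE mem_setE (negbTE yab) mul0r.
    by under eq_integral do rewrite mul0e; rewrite integral0.
  have fiy : mu.-integrable `[y, b] (EFin \o f).
    apply: integrableS fi => //; apply: subset_itvr; rewrite bnd_simp.
    by move: yab; rewrite in_itv => /andP[].
  rewrite integralZl//; last by apply/integrable_restrict => //; rewrite setTI.
  by rewrite -integral_mkcond EFinM fineK// integrable_fin_num.
have hi : (mu \x mu)%E.-integrable setT (EFin \o h).
  apply/integrable12ltyP; first exact/measurable_EFinP.
  have /integrableP[mfa' fafin] := fai; have /integrableP[mga' gafin] := gai.
  (* The absolute value of [h] is dominated by the product of those of [fa] and [ga], whose double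
     integral factors into two finite ones. *)
  apply: (@le_lt_trans _ _ (\int[mu]_x (`|(fa x)%:E| * \int[mu]_y `|(ga y)%:E|))%E).
    apply: ge0_le_integral => //.
    + by move=> x _; apply: integral_ge0.
    + apply: (@measurable_fun_fubini_tonelli_F _ _ _ _ R mu (abse \o (EFin \o h))); last first.
        by move=> z; rewrite abse_ge0.
      by apply: measurableT_comp => //; exact/measurable_EFinP.
    + apply: emeasurable_funM => //.
      exact: measurableT_comp.
    + move=> x _; rewrite -ge0_integralZl//; last exact: measurableT_comp.
      apply: ge0_le_integral => //.
      * apply: measurableT_comp => //; apply/measurable_EFinP.
        by apply: measurableT_comp mh _; exact: measurable_pair1.
      * by apply: emeasurable_funM => //; exact: measurableT_comp.
      * move=> y _; rewrite /h /=; case: ifP => _; first by rewrite -EFinM lee_fin normrM.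
        by rewrite normr0 mule_ge0.
  rewrite ge0_integralZr//; [|exact: measurableT_comp|exact: integral_ge0].
  by rewrite lte_mul_pinfty// ?integral_ge0// ge0_fin_numE// integral_ge0.
have := Fubini hi; rewrite /=.
under eq_integral do rewrite h1.
under [in X in _ = X -> _]eq_integral do rewrite h2.
move=> /(congr1 fine) H.
rewrite Rintegral_mkcond [RHS]Rintegral_mkcond.
have -> : (fun x : R => f x * \int[mu]_(y in `[a, x]) g y) \_ `[a, b] =
   (fun x => fa x * \int[mu]_(y in `[a, x]) g y).
  by apply/funext => x; rewrite /fa /patch; case: ifP => // _; rewrite mul0r.
have -> : (fun y : R => g y * \int[mu]_(x in `[y, b]) f x) \_ `[a, b] =
   (fun y => ga y * \int[mu]_(x in `[y, b]) f x).
  by apply/funext => x; rewrite /ga /patch; case: ifP => // _; rewrite mul0r.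
exact: H.
Qed.

End fubini_by_parts.

(** * Test functions and primitives on the line *)

Section test_functions.
Context {R : realType}.
Local Notation mu := (@lebesgue_measure R).
Implicit Types (f g : R -> R) (a b x y : R).

Lemma supp_sub_closed {V : normedModType R} (F : set V) (f : V -> R) :
  closed F -> (forall z : V, ~ F z -> f z = 0) -> supp f `<=` F.
Proof.
move=> cF f0; rewrite /supp closureE; apply: bigcap_inf; split => // z /= fz0.
by apply: contrapT => /f0 fz; rewrite fz eqxx in fz0.
Qed.

Lemma test_function_itv (O : set R) f a b : smooth f ->
  (forall x, x \notin `[a, b] -> f x = 0) -> `[a, b] `<=` O -> test_function O f.
Proof.
move=> sf f0 abO.
have sab : supp f `<=` `[a, b].
  apply: supp_sub_closed => [|x xab]; first exact: itv_closed.
  by apply: f0; exact/negP.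
split => //; last exact: subset_trans abO.
by apply: (subclosed_compact _ (@segment_compact _ a b)) => //; exact: closed_closure.
Qed.

Lemma test_function_bounded (O : set R) f : test_function O f ->
  exists2 M, 0 < M & forall x, x \notin `[- M, M] -> f x = 0.
Proof.
move=> [_ /compact_bounded[M [_ HM]] _].
exists (`|M| + 1); first by rewrite ltr_wpDl.
move=> x; apply: contraNeq => fx0; rewrite in_itv /= -ler_norml.
apply: (HM (`|M| + 1)); first by rewrite ltr_pwDr// ler_norm.
exact: subset_closure.
Qed.

Lemma smooth_integrable f a b : smooth f -> mu.-integrable `[a, b] (EFin \o f).
Proof.
move=> sf; apply: continuous_compact_integrable; first exact: segment_compact.
exact/continuous_subspaceT/smooth_continuous.
Qed.

Lemma smooth_integrableT f a b : smooth f ->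
  (forall x, x \notin `[a, b] -> f x = 0) -> mu.-integrable setT (EFin \o f).
Proof.
move=> sf f0; rewrite (_ : EFin \o f = (EFin \o f) \_ `[a, b]).
  by apply/integrable_restrict => //; rewrite setTI; exact: smooth_integrable.
apply/funext => x; rewrite patchE mem_setE; case: ifPn => // /f0 /= ->//.
Qed.

(** The primitive from -oo vanishes to the left of a because f does, and to the right of b because f
    has mean zero. *)
Lemma smooth_primitive_exists f a b : smooth f ->
  (forall x, x \notin `[a, b] -> f x = 0) -> \int[mu]_(x in `[a, b]) f x = 0 ->
  exists F, [/\ smooth F, forall x, x \notin `[a, b] -> F x = 0 & derive1 F = f].
Proof.
move=> sf f0 I0.
pose F x := \int[mu]_(y in `]-oo, x]) f y.
have dF x : is_derive x 1 F (f x).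
  have fi : mu.-integrable `]-oo, (x + 1)] (EFin \o f).
    by apply: integrableS (smooth_integrableT sf f0).
  have x1 : x < x + 1 by rewrite ltrDl.
  have [] := continuous_FTC1 x1 fi (ltNyr _) (@smooth_continuous _ _ f sf x).
  by rewrite derive1E => dF <-; split.
exists F; split.
- exact: smooth_primitive dF sf.
- move=> x xab; rewrite /F; have [xa|ax] := ltP x a.
    rewrite (@eq_Rintegral _ _ _ _ _ (cst 0)) ?Rintegral_cst ?mul0r//.
    move=> y; rewrite inE /= in_itv /= => yx; apply: f0.
    by rewrite in_itv /= leNgt (le_lt_trans yx xa).
  rewrite -I0; apply: Rintegral_restrict.
    move=> y; rewrite /= !in_itv /= => /andP[_ yb]; apply: le_trans yb _.
    by move: xab; rewrite in_itv /= ax /= -ltNge => /ltW.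
  by move=> y _ yab; apply: f0; exact/negP.
- by apply/funext => x; rewrite derive1E derive_val.
Qed.

Lemma cutoff_notin a b k x : 0 < k -> x \notin `[a, b] -> cutoff a b k x = 0.
Proof.
move=> k0 xab; apply: cutoff_eq0 => //; apply: contra xab => /andP[ax xb].
by rewrite in_itv /= !ltW.
Qed.

(** Dominated convergence with majorant |f|; the limit indicator is that of the open interval, whose
    endpoints are negligible. This recovers integrals over subintervals from smooth test
    functions. *)
Lemma cutoff_integral_cvg f a b c d : a <= c -> c <= d -> d <= b ->
  mu.-integrable `[a, b] (EFin \o f) ->
  \int[mu]_(x in `[a, b]) (f x * cutoff c d n.+1%:R x) @[n --> \oo] -->
  \int[mu]_(x in `[c, d]) f x.
Proof.
move=> ac cd db fi.
have mf : measurable_fun `[a, b] f by apply/measurable_EFinP; exact: measurable_int fi.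
have mb k : measurable_fun `[a, b] (cutoff c d k).
  by apply: measurable_funTS (continuous_measurable_fun (smooth_continuous (smooth_cutoff c d k))).
have m1 : measurable_fun `[a, b] (\1_`]c, d[ : R -> R).
  by apply: measurable_funTS; exact: measurable_indic.
have := @dominated_convergence _ _ R mu `[a, b] (measurable_itv _)
  (fun n x => (f x * cutoff c d n.+1%:R x)%:E) (fun x => (f x * \1_`]c, d[ x)%:E)
  (fun x => `|(f x)%:E|)%E.
case.
- by move=> n; apply/measurable_EFinP; apply: measurable_funM; [exact: mf|exact: mb].
- by apply/measurable_EFinP; apply: measurable_funM; [exact: mf|exact: m1].
- apply: nearW => x _; apply: cvg_EFin; first exact: nearW.
  by apply: cvgM; [exact: cvg_cst|exact: cutoff_cvg].
- exact: integrable_abse.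
- apply: nearW => x n _; rewrite lee_fin normrM ler_piMr// ger0_norm ?cutoff_ge0//.
  exact: cutoff_le1.
move=> fi1 _ H.
have -> : \int[mu]_(x in `[c, d]) f x = \int[mu]_(x in `[a, b]) (f x * \1_`]c, d[ x).
  have fcd : mu.-integrable `[c, d] (EFin \o f).
    by apply: integrableS fi => //; apply: subset_itvScc; rewrite bnd_simp.
  have e1 : \int[mu]_(x in `]c, d]) f x = \int[mu]_(x in `[c, d]) f x.
    by apply: Rintegral_itv_obnd_cbnd; apply: integrableS fcd => //; exact: subset_itv_oc_cc.
  have e2 : \int[mu]_(x in `]c, d[) f x = \int[mu]_(x in `]c, d]) f x.
    by apply: Rintegral_itv_bndo_bndc; apply: integrableS fcd => //; exact: subset_itv_oo_cc.
  rewrite -e1 -e2.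
  transitivity (\int[mu]_(x in `]c, d[) (f x * \1_`]c, d[ x)).
    by apply: eq_Rintegral => x xcd; rewrite indicE xcd mulr1.
  apply/esym; apply: Rintegral_restrict; first by apply: subset_itvScc; rewrite bnd_simp.
  by move=> x _ xcd; rewrite indicE memNset// mulr0.
apply: (@fine_cvg _ _ _ _ (fun n => \int[mu]_(x in `[a, b]) (f x * cutoff c d n.+1%:R x)%:E)%E).
rewrite /Rintegral fineK; first exact: H.
exact: integrable_fin_num.
Qed.

End test_functions.

(** * Weak derivatives on the line *)

Section dubois_reymond.
Context {R : realType}.
Local Notation mu := (@lebesgue_measure R).
Implicit Types (f g k : R -> R) (a b x y : R).

Lemma smooth_measurable f D : smooth f -> measurable_fun D f.
Proof.
by move=> sf; apply: measurable_funTS; exact: continuous_measurable_fun (smooth_continuous sf).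
Qed.

Lemma continuous_itv_bounded f a b : {within `[a, b], continuous f} ->
  exists C, forall x, x \in `[a, b] -> `|f x| <= C.
Proof.
move=> cf; have /compact_bounded[M [_ HM]] := continuous_compact cf (@segment_compact _ a b).
exists (`|M| + 1) => x xab; apply: (HM (`|M| + 1)); first by rewrite ltr_pwDr// ler_norm.
by exists x.
Qed.

Lemma smooth_bounded f a b : smooth f -> exists C, forall x, x \in `[a, b] -> `|f x| <= C.
Proof. by move=> sf; exact/continuous_itv_bounded/continuous_subspaceT/smooth_continuous. Qed.

Lemma integrableM_smooth f g a b : mu.-integrable `[a, b] (EFin \o f) -> smooth g ->
  mu.-integrable `[a, b] (EFin \o (fun x => f x * g x)).
Proof.
move=> fi sg; have [C HC] := @smooth_bounded g a b sg.
apply: (@integrable_Mbound _ _ _ mu _ _ _ C) => //; first exact: smooth_measurable.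
by apply: nearW => x; exact: HC.
Qed.

Lemma Rintegral_cst_itv a b (c : R) : a <= b -> \int[mu]_(x in `[a, b]) c = c * (b - a).
Proof.
move=> ab; rewrite Rintegral_cst//; congr (_ * _).
transitivity (fine (mu `[a, b])); first by [].
rewrite lebesgue_measure_itv /= lte_fin.
by move: ab; rewrite le_eqVlt => /predU1P[->|->]//=; rewrite ltxx subrr.
Qed.

(** The integrals of the cutoffs tend to b - a > 0, so one of them is positive and can be
    normalised. *)
Lemma exists_cutoff_integral1 a b : a < b ->
  exists z : R -> R, [/\ smooth z, forall x, x \notin `[a, b] -> z x = 0,
    forall x, 0 <= z x & \int[mu]_(x in `[a, b]) z x = 1].
Proof.
move=> ab.
have i1 : mu.-integrable `[a, b] (EFin \o cst (1 : R)).
  by apply: smooth_integrable; exact: smooth_cst.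
have := cutoff_integral_cvg (lexx a) (ltW ab) (lexx b) i1.
rewrite Rintegral_cst_itv ?ltW// mul1r => H.
have [n] : exists n, 0 < \int[mu]_(x in `[a, b]) (cst 1 x * cutoff a b n.+1%:R x).
  near \oo => n; exists n; near: n.
  by apply: (cvgr_gt (b - a)) => //; rewrite subr_gt0.
under eq_Rintegral do rewrite mul1r.
set I := \int[mu]_(x in _) _ => I0.
exists (cst I^-1 * cutoff a b n.+1%:R); split.
- by apply: smoothM; [exact: smooth_cst|exact: smooth_cutoff].
- by move=> x xab; rewrite /GRing.mul /= cutoff_notin ?mulr0.
- by move=> x; rewrite mulr_ge0 ?cutoff_ge0// invr_ge0 ltW.
- rewrite RintegralZl//; first by rewrite mulVf// gt_eqF.
  by apply: smooth_integrable; exact: smooth_cutoff.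
Unshelve. all: by end_near. Qed.

(** A test function is a derivative of a test function exactly when its mean is zero; subtracting a
    multiple of a fixed bump [z] achieves this. The constant is therefore the average of k against
    [z]. *)
Lemma dubois_reymond k a b : a < b -> mu.-integrable `[a, b] (EFin \o k) ->
  (forall th, smooth th -> (forall x, x \notin `[a, b] -> th x = 0) ->
     \int[mu]_(x in `[a, b]) (k x * derive1 th x) = 0) ->
  exists c, {ae mu, forall x, x \in `[a, b] -> k x = c}.
Proof.
move=> ab ki Hk.
have [z [sz z0 _ Iz]] := exists_cutoff_integral1 ab.
pose c := \int[mu]_(x in `[a, b]) (k x * z x).
have Heta eta : smooth eta -> (forall x, x \notin `[a, b] -> eta x = 0) ->
    \int[mu]_(x in `[a, b]) (k x * eta x) = c * \int[mu]_(x in `[a, b]) eta x.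
  move=> se e0; pose I := \int[mu]_(x in `[a, b]) eta x.
  have sIz : smooth (cst (- I) * z) by apply: smoothM => //; exact: smooth_cst.
  have [th [sth th0 thE]] : exists F, [/\ smooth F, forall x, x \notin `[a, b] -> F x = 0 &
      derive1 F = eta + cst (- I) * z].
    apply: smooth_primitive_exists; first exact: smoothD.
      by move=> x xab; rewrite !fctE e0// z0// mulr0 addr0.
    rewrite RintegralD//; [|exact: smooth_integrable|exact: smooth_integrable].
    rewrite RintegralZl//; last exact: smooth_integrable.
    by rewrite Iz mulr1 subrr.
  have := Hk th sth th0; rewrite thE.
  rewrite (@eq_Rintegral _ _ _ mu _ (fun x => k x * eta x + (- I) * (k x * z x))); last first.
    by move=> x _; rewrite !fctE; ring.
  rewrite RintegralD//; [|exact: integrableM_smooth|]; last first.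
    by apply: (@integrableZl _ _ _ mu `[a, b] _ (- I) (EFin \o (fun x => k x * z x))) => //; exact: integrableM_smooth.
  rewrite RintegralZl//; last exact: integrableM_smooth.
  by rewrite -/c mulNr => /eqP; rewrite subr_eq0 mulrC => /eqP.
(* Letting eta tend to the indicator of [a, x] turns [Heta] into a formula for the primitive of
   k. *)
have Ix x : a <= x -> x <= b -> \int[mu]_(y in `[a, x]) k y = c * (x - a).
  move=> ax xb.
  have i1 : mu.-integrable `[a, b] (EFin \o cst (1 : R)).
    by apply: smooth_integrable; exact: smooth_cst.
  have H1 := cutoff_integral_cvg (lexx a) ax xb i1.
  have Hk1 := cutoff_integral_cvg (lexx a) ax xb ki.
  have E : (fun n => \int[mu]_(y in `[a, b]) (k y * cutoff a x n.+1%:R y)) =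
           (fun n => c * \int[mu]_(y in `[a, b]) (cst 1 y * cutoff a x n.+1%:R y)).
    apply/funext => n; rewrite Heta; last first.
    - move=> y yab; apply: cutoff_notin => //; apply: contra yab.
      by apply: subset_itvl; rewrite bnd_simp.
    - exact: smooth_cutoff.
    by congr (_ * _); apply: eq_Rintegral => y _; rewrite mul1r.
  have : (fun n => c * \int[mu]_(y in `[a, b]) (cst 1 y * cutoff a x n.+1%:R y)) @ \oo -->
      c * \int[mu]_(y in `[a, x]) cst 1 y by apply: cvgM => //; exact: cvg_cst.
  rewrite -E => /(cvg_unique _ Hk1) ->//.
  by rewrite Rintegral_cst_itv// mul1r.
exists c.
(* The extension of k - c by zero has an identically vanishing primitive from -oo, so Lebesgue
   differentiation gives k = c almost everywhere. *)
pose g := (fun x => k x - c) \_ `[a, b].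
have kci : mu.-integrable `[a, b] (EFin \o (fun x => k x - c)).
  have ci : mu.-integrable `[a, b] (EFin \o cst c).
    by apply: smooth_integrable; exact: smooth_cst.
  exact: (integrableB _ ki ci).
have gi : mu.-integrable setT (EFin \o g).
  by rewrite /g -restrict_EFin; apply/integrable_restrict => //; rewrite setTI.
have lg : locally_integrable setT g by apply: integrable_locally.
have F0 x : \int[mu]_(y in `]-oo, x]) g y = 0.
  have [xa|ax] := ltP x a.
    rewrite (@eq_Rintegral _ _ _ mu _ (cst 0)) ?Rintegral_cst ?mul0r//.
    move=> y; rewrite inE /= in_itv /= => yx.
    by rewrite /g patchE mem_setE in_itv /= leNgt (le_lt_trans yx xa).
  pose m := Num.min x b.
  have am : a <= m by rewrite le_min ax ltW.
  have mb : m <= b by rewrite ge_min lexx orbT.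
  transitivity (\int[mu]_(y in `[a, m]) g y).
    apply: Rintegral_restrict => y.
      by rewrite /= !in_itv /= le_min => /andP[_ /andP[]].
    rewrite /= !in_itv /= => yx yam; rewrite /g patchE mem_setE in_itv /=.
    case: ifPn => // /andP[ay yb]; exfalso; apply: yam.
    by rewrite ay le_min yx yb.
  transitivity (\int[mu]_(y in `[a, m]) (k y - c)).
    apply: eq_Rintegral => y; rewrite mem_setE /g patchE mem_setE !in_itv /=.
    by move=> /andP[-> ym]; rewrite (le_trans ym mb).
  rewrite RintegralB//.
  - by rewrite Ix// Rintegral_cst_itv// subrr.
  - by apply: integrableS ki => //; apply: subset_itvl; rewrite bnd_simp.
  - by apply: smooth_integrable; exact: smooth_cst.
have giy y : mu.-integrable `]-oo, y] (EFin \o g) by apply: integrableS gi.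
have := FTC1Ny giy lg.
apply: ae_imp => x [_].
rewrite (_ : (fun x => _) = cst 0); last by apply/funext => y; exact: F0.
rewrite derive1_cst => gx xab; move: gx; rewrite /g patchE mem_setE xab.
by move/esym/eqP; rewrite subr_eq0 => /eqP.
Qed.

End dubois_reymond.

Section weak_derivatives.
Context {R : realType}.
Local Notation mu := (@lebesgue_measure R).
Implicit Types (f g F v w : R -> R) (a b x y : R).

(** The support condition speaks only of points off the closed interval; a one-sided limit gives the
    value at the endpoint, which is the boundary term in integrations by parts. *)
Lemma continuous_itv_bound0 f a b : continuous f ->
  (forall x, x \notin `[a, b] -> f x = 0) -> f b = 0.
Proof.
move=> cf f0.
have H1 : f x @[x --> b^'+] --> f b by apply: cvg_at_right_filter; exact: cf.
have H2 : f x @[x --> b^'+] --> (0 : R).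
  apply: cvg_near_cst; near=> x; rewrite f0//.
  by rewrite in_itv /= negb_and -!ltNge; apply/orP; right.
exact: (cvg_unique _ H1 H2).
Unshelve. all: by end_near. Qed.

Lemma continuous_itv_bound0l f a b : continuous f ->
  (forall x, x \notin `[a, b] -> f x = 0) -> f a = 0.
Proof.
move=> cf f0.
have H1 : f x @[x --> a^'-] --> f a by apply: cvg_at_left_filter; exact: cf.
have H2 : f x @[x --> a^'-] --> (0 : R).
  apply: cvg_near_cst; near=> x; rewrite f0//.
  by rewrite in_itv /= negb_and -!ltNge; apply/orP; left.
exact: (cvg_unique _ H1 H2).
Unshelve. all: by end_near. Qed.

Lemma derive1_itv0 f a b x : (forall x, x \notin `[a, b] -> f x = 0) ->
  x \notin `[a, b] -> derive1 f x = 0.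
Proof.
move=> f0 xab; rewrite derive1E.
suff /near_eq_is_derive/(_ (is_derive_cst (0 : R) x 1)) [] : \near x, cst 0 x = f x by [].
have : nbhs x (~` `[a, b]).
  by apply: open_nbhs_nbhs; split; [exact/closed_openC/itv_closed|exact/negP].
by apply: filterS => y /negP; rewrite /= => /f0.
Qed.

Lemma smooth_FTC2 f y b : y <= b -> smooth f ->
  \int[mu]_(x in `[y, b]) derive1 f x = f b - f y.
Proof.
move=> yb sf; move: yb; rewrite le_eqVlt => /predU1P[->|yb].
  by rewrite set_itv1 Rintegral_set1 subrr.
rewrite /Rintegral (@continuous_FTC2 _ _ f)//.
- exact/continuous_subspaceT/smooth_continuous/smooth_derive1.
- split; [|apply: cvg_at_right_filter|apply: cvg_at_left_filter].
  + by move=> x _; exact: smooth_derivable.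
  + exact: smooth_continuous.
  + exact: smooth_continuous.
Qed.

Lemma primitive_integrable g a b : a < b -> mu.-integrable `[a, b] (EFin \o g) ->
  mu.-integrable `[a, b] (EFin \o (fun x => \int[mu]_(y in `[a, x]) g y)).
Proof.
move=> ab gi; apply: continuous_compact_integrable; first exact: segment_compact.
exact: parameterized_integral_continuous (ltW ab) gi.
Qed.

(** As g is merely integrable, its primitive need not be differentiable everywhere. Exchanging the
    integrals leaves, against g(y), the integral of th' over [y, b], which is th(b) - th(y). *)
Lemma smooth_primitive_by_parts g th a b : a < b -> mu.-integrable `[a, b] (EFin \o g) ->
  smooth th ->
  \int[mu]_(x in `[a, b]) (derive1 th x * \int[mu]_(y in `[a, x]) g y) =
  th b * \int[mu]_(y in `[a, b]) g y - \int[mu]_(y in `[a, b]) (g y * th y).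
Proof.
move=> ab gi sth.
rewrite Rintegral_triangle//; last exact/smooth_integrable/smooth_derive1.
rewrite -RintegralZl// -RintegralB//.
- apply: eq_Rintegral => y; rewrite mem_setE in_itv /= => /andP[_ yb].
  by rewrite smooth_FTC2//; ring.
- exact: (@integrableZl _ _ _ mu `[a, b] (measurable_itv _) (th b) _ gi).
- exact: integrableM_smooth.
Qed.

(** By parts, f minus the primitive of g is orthogonal to all derivatives of test functions, hence
    constant. It serves in the space variable for weak derivatives and in the time variable for the
    moments. *)
Lemma weak_primitive f g a b : a < b ->
  mu.-integrable `[a, b] (EFin \o f) -> mu.-integrable `[a, b] (EFin \o g) ->
  (forall th, smooth th -> (forall x, x \notin `[a, b] -> th x = 0) ->
     \int[mu]_(x in `[a, b]) (f x * derive1 th x) = - \int[mu]_(x in `[a, b]) (g x * th x)) ->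
  exists c, {ae mu, forall x, x \in `[a, b] -> f x = c + \int[mu]_(y in `[a, x]) g y}.
Proof.
move=> ab fi gi H.
have Pi := primitive_integrable ab gi.
have [|th sth th0|c Hc] := @dubois_reymond R (fun x => f x - \int[mu]_(y in `[a, x]) g y) a b ab.
- exact: (integrableB _ fi Pi).
- transitivity (\int[mu]_(x in `[a, b]) (f x * derive1 th x -
      derive1 th x * \int[mu]_(y in `[a, x]) g y)).
    by apply: eq_Rintegral => x _; ring.
  rewrite RintegralB//.
  + rewrite H// smooth_primitive_by_parts//.
    rewrite (@continuous_itv_bound0 th a b)//; last exact: smooth_continuous.
    by rewrite mul0r sub0r subrr.
  + exact/integrableM_smooth/smooth_derive1.
  + rewrite (_ : EFin \o _ = EFin \o (fun x => (\int[mu]_(y in `[a, x]) g y) * derive1 th x)).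
      exact/integrableM_smooth/smooth_derive1.
    by apply/funext => x /=; rewrite mulrC.
exists c; move: Hc; apply: ae_imp => x Hx xab.
by rewrite -(Hx xab) subrK.
Qed.

Lemma locally_integrable_itv f a b : locally_integrable setT f ->
  mu.-integrable `[a, b] (EFin \o f).
Proof.
move=> [mf _ /(_ [set` `[a, b]] (@subsetT _ _) (@segment_compact _ a b)) foo].
apply/integrableP; split => //.
by apply/measurable_EFinP; exact: measurable_funTS.
Qed.

Lemma weak_derivative_primitive f g a b : a < b -> weak_derivative 1 f g ->
  exists c, {ae mu, forall x, x \in `[a, b] -> f x = c + \int[mu]_(y in `[a, x]) g y}.
Proof.
move=> ab [lf lg H]; apply: weak_primitive => //; try exact: locally_integrable_itv.
move=> th sth th0.
have := H th (test_function_itv sth th0 (@subsetT _ _)).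
rewrite expr1 mulN1r derive1n1.
rewrite (@Rintegral_restrict _ _ _ mu setT `[a, b])//; last first.
  by move=> x _ xab; rewrite (derive1_itv0 th0) ?mulr0//; exact/negP.
rewrite [X in - X](@Rintegral_restrict _ _ _ mu setT `[a, b])//.
by move=> x _ xab; rewrite th0 ?mulr0//; exact/negP.
Qed.

End weak_derivatives.

(** * Integration by parts and product rule for weak derivatives *)

Section weak_products.
Context {R : realType}.
Local Notation mu := (@lebesgue_measure R).
Implicit Types (f g F v w phi : R -> R) (a b x y : R).

Lemma ae_itv_witness (P : R -> Prop) a b : a < b -> {ae mu, forall x, P x} ->
  exists2 x, x \in `[a, b] & P x.
Proof.
move=> ab [N [mN N0 PN]]; apply: contrapT => H.
have : (mu `[a, b] <= 0)%E.
  rewrite -N0 le_measure ?inE//.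
  by move=> x xab; apply: PN => /= Px; apply: H; exists x.
by rewrite lebesgue_measure_itv /= lte_fin ab -EFinD lee_fin leNgt subr_gt0 ab.
Qed.

Lemma ae_eq_continuous f g a b : a < b ->
  {within `[a, b], continuous f} -> {within `[a, b], continuous g} ->
  {ae mu, forall x, x \in `[a, b] -> f x = g x} -> forall x, x \in `[a, b] -> f x = g x.
Proof.
move=> ab cf cg fg x xab; apply/eqP; rewrite -subr_eq0; apply/negPn/negP => fgx.
have : {within `[a, b], continuous (f - g)} by exact: within_continuousB.
move=> /subspace_continuousP/(_ x xab)/cvgrPdist_lt/(_ `|f x - g x|).
rewrite normr_gt0 => /(_ fgx); rewrite near_withinE => /nbhs_ballP[d /= d0 Hd].
have /andP[ax xb] : a <= x <= b by move: xab; rewrite in_itv.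
(* The half radius keeps this interval inside the open ball where f and g differ; clipping to [a, b]
   leaves it of positive length. *)
pose c := Num.max a (x - d / 2); pose e := Num.min b (x + d / 2).
have d2 : 0 < d / 2 by rewrite divr_gt0.
have ce : c < e.
  by rewrite /c /e gt_max !lt_min ab /=; apply/andP; split; [|apply/andP; split]; lra.
have [y] := ae_itv_witness ce fg; rewrite in_itv /= ge_max le_min.
move=> /andP[/andP[ay xy] /andP[yb yx]]; rewrite in_itv /= ay yb => /(_ isT) fgy.
have : ball x d y by rewrite /ball /= ltr_norml; apply/andP; split; lra.
move=> /Hd/= ; rewrite in_itv /= ay yb => /(_ isT).
by rewrite /from_subspace !fctE fgy subrr subr0 ltxx.
Qed.

Lemma Rintegral_itv_split f a b x : a <= x -> x <= b -> mu.-integrable `[a, b] (EFin \o f) ->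
  \int[mu]_(y in `[x, b]) f y = \int[mu]_(y in `[a, b]) f y - \int[mu]_(y in `[a, x]) f y.
Proof.
move=> ax xb fi; rewrite Rintegral_itvB ?bnd_simp//.
rewrite Rintegral_itv_obnd_cbnd//; apply: integrableS fi => //.
by apply: subset_itvr; rewrite bnd_simp.
Qed.

(** Neither factor is smooth, so the definition of weak derivative does not apply directly. Both
    functions are written as primitives, and the identity becomes Fubini on a triangle. *)
Lemma weak_by_parts F w v g M : 0 < M ->
  weak_derivative 1 F w -> weak_derivative 1 v g ->
  (forall x, x \notin `[- M, M] -> F x = 0) ->
  (forall x, x \notin `[- M, M] -> w x = 0) ->
  \int[mu]_x (w x * v x) = - \int[mu]_x (g x * F x).
Proof.
(* The margin 1 on either side gives strips of positive measure on which F and w vanish. Sampling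
   the almost everywhere identity for F there yields c1 = 0 on the left and a zero integral of w on
   the right. *)
move=> M0 dF dv F0 w0; pose a := - M - 1; pose b := M + 1.
have ab : a < b by rewrite /a /b; lra.
have [c1 Fc] := weak_derivative_primitive ab dF.
have [c vc] := weak_derivative_primitive ab dv.
have [lF lw _] := dF; have [lv lg _] := dv.
have [mF _ _] := lF; have [mw _ _] := lw; have [mv _ _] := lv; have [mg _ _] := lg.
have wi := @locally_integrable_itv _ _ a b lw.
have gi := @locally_integrable_itv _ _ a b lg.
have nM x : x \in `[- M, M] -> x \in `[a, b].
  by rewrite !in_itv /= /a /b => /andP[? ?]; lra.
have c10 : c1 = 0.
  have aa : a < a + 2^-1 by lra.
  have [x] := ae_itv_witness aa Fc; rewrite in_itv /= => /andP[ax xa] /(_ _)/esym.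
  rewrite F0; last by rewrite in_itv /= negb_and -!ltNge; apply/orP; left; rewrite /a in xa; lra.
  rewrite (@eq_Rintegral _ _ _ mu _ (cst 0)) ?Rintegral_cst ?mul0r ?addr0//.
    by apply; rewrite in_itv /= ax /b; rewrite /a in xa; lra.
  move=> y; rewrite mem_setE in_itv /= => /andP[_ yx]; apply: w0.
  by rewrite in_itv /= negb_and -!ltNge; apply/orP; left; rewrite /a in xa; lra.
have W0 : \int[mu]_(y in `[a, b]) w y = 0.
  have bb : b - 2^-1 < b by lra.
  have [x] := ae_itv_witness bb Fc; rewrite in_itv /= => /andP[bx xb] /(_ _)/esym.
  rewrite F0; last by rewrite in_itv /= negb_and -!ltNge; apply/orP; right; rewrite /b in bx; lra.
  rewrite c10 add0r => <-; last by rewrite in_itv /= xb andbT /a; rewrite /b in bx; lra.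
  apply: Rintegral_restrict => y; rewrite /= !in_itv /=.
    by move=> /andP[-> yx]; exact: le_trans yx xb.
  move=> /andP[ay yb] /negP; rewrite ay /= -ltNge => xy; apply: w0.
  by rewrite in_itv /= negb_and -!ltNge; apply/orP; right; rewrite /b in bx; lra.
rewrite (@Rintegral_restrict _ _ _ mu setT `[a, b])//; last first.
  by move=> x _ xab; rewrite w0 ?mul0r//; apply/negP => /nM.
rewrite [X in - X](@Rintegral_restrict _ _ _ mu setT `[a, b])//; last first.
  by move=> x _ xab; rewrite F0 ?mulr0//; apply/negP => /nM.
have Pg := primitive_integrable ab gi; have Pw := primitive_integrable ab wi.
have mPg : measurable_fun `[a, b] (fun x => \int[mu]_(y in `[a, x]) g y).
  by apply/measurable_EFinP; exact: measurable_int Pg.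
have mPw : measurable_fun `[a, b] (fun x => \int[mu]_(y in `[a, x]) w y).
  by apply/measurable_EFinP; exact: measurable_int Pw.
have [Cg HCg] := continuous_itv_bounded (parameterized_integral_continuous (ltW ab) gi).
(* The unknown constant c in v = c + \int g disappears because w has integral zero. *)
transitivity (\int[mu]_(x in `[a, b]) (c * w x + w x * \int[mu]_(y in `[a, x]) g y)).
  apply: ae_eq_Rintegral => //.
  - by apply: measurable_funTS; exact: measurable_funM.
  - apply: measurable_funD; apply: measurable_funM => //; exact: measurable_funTS.
  - by apply: ae_imp vc => x vc xab; rewrite vc//; ring.
rewrite RintegralD//; last 2 first.
- exact: (@integrableZl _ _ _ mu `[a, b] (measurable_itv _) c _ wi).
- by apply: (integrable_Mbound (K := Cg)) => //; apply: aeW => x; exact: HCg.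
rewrite RintegralZl// W0 mulr0 add0r Rintegral_triangle//.
have [Cw HCw] := continuous_itv_bounded (parameterized_integral_continuous (ltW ab) wi).
rewrite -mulN1r -RintegralZl//; last first.
  apply: (integrable_Mbound (K := Cw)) => //; first exact: measurable_funTS.
  by apply: ae_imp Fc => x Fc xab; rewrite Fc// c10 add0r; exact: HCw.
(* Again because w has integral zero, its integral over [y, b] is minus the one over [a, y], that
   is, -F(y) for almost every y. *)
transitivity (\int[mu]_(y in `[a, b]) (- g y * \int[mu]_(x in `[a, y]) w x)).
  apply: eq_Rintegral => y; rewrite mem_setE in_itv /= => /andP[ay yb].
  by rewrite (@Rintegral_itv_split _ a)// W0; ring.
apply: ae_eq_Rintegral => //.
- by apply: measurable_funM => //; apply: measurable_funTS; exact: measurableT_comp.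
- by apply: measurable_funM => //; apply: measurable_funTS; exact: measurable_funM.
- by apply: ae_imp Fc => x Fc xab; rewrite Fc// c10 add0r; ring.
Qed.

Lemma locally_integrableM_continuous f phi : locally_integrable setT f -> continuous phi ->
  locally_integrable setT (fun x => phi x * f x).
Proof.
move=> [mf oT lf] cphi; have mphi := continuous_measurable_fun cphi.
split => //; first exact: measurable_funM.
move=> K KT cK; have mK := compact_measurable cK.
have /compact_bounded[M [_ HM]] := continuous_compact (continuous_subspaceT cphi) cK.
have fi : mu.-integrable K (EFin \o f).
  apply/integrableP; split; last exact: lf.
  by apply/measurable_EFinP; exact: measurable_funTS.
have : mu.-integrable K (EFin \o (fun x => f x * phi x)).
  apply: (integrable_Mbound (K := `|M| + 1)) => //; first exact: measurable_funTS.
  apply: aeW => x Kx; apply: (HM (`|M| + 1)); first by rewrite ltr_pwDr// ler_norm.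
  by exists x.
move=> /integrableP[_]; apply: le_lt_trans.
by rewrite le_eqVlt; apply/orP; left; apply/eqP; apply: eq_integral => x _; rewrite mulrC.
Qed.

Lemma locally_integrableM_test f phi a b : locally_integrable setT f -> smooth phi ->
  (forall x, x \notin `[a, b] -> phi x = 0) ->
  mu.-integrable setT (EFin \o (fun x => f x * phi x)).
Proof.
move=> lf sphi phi0.
rewrite (_ : EFin \o _ = (EFin \o (fun x => f x * phi x)) \_ `[a, b]).
  apply/integrable_restrict => //; rewrite setTI; apply: integrableM_smooth => //.
  exact: locally_integrable_itv.
apply/funext => x; rewrite patchE mem_setE; case: ifPn => // /phi0 /= ->.
by rewrite mulr0.
Qed.

Lemma derive1M_smooth f g : smooth f -> smooth g ->
  derive1 (f * g) = derive1 f * g + f * derive1 g.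
Proof.
move=> sf sg; apply/funext => x; rewrite derive1E deriveM; [|exact: smooth_derivable..].
by rewrite !fctE !derive1E /GRing.scale /=; ring.
Qed.

(** If eta is a test function, so is eta phi; the term eta phi' in its derivative is what becomes
    the first summand of the new weak derivative. *)
Lemma weak_derivativeM f g phi : smooth phi -> weak_derivative 1 f g ->
  weak_derivative 1 (fun x => phi x * f x) (fun x => derive1 phi x * f x + phi x * g x).
Proof.
move=> sphi [lf lg H].
have sphi' := smooth_derive1 sphi.
split.
- exact: locally_integrableM_continuous (smooth_continuous _).
- by apply: locally_integrableD; apply: locally_integrableM_continuous => //; exact: smooth_continuous.
move=> eta teta; have [seta _ _] := teta.
have [M M0 eta0] := test_function_bounded teta.
have seta' := smooth_derive1 seta.
have ephi0 x : x \notin `[- M, M] -> (eta * phi) x = 0.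
  by move=> xM; rewrite /GRing.mul /= eta0// mul0r.
have sephi : smooth (eta * phi) by exact: smoothM.
have := H (eta * phi) (test_function_itv sephi ephi0 (@subsetT _ _)).
rewrite expr1 !mulN1r !derive1n1 => E.
have eta'0 x : x \notin `[- M, M] -> derive1 eta x = 0 by exact: derive1_itv0.
have i1 : mu.-integrable setT (EFin \o (fun x => f x * (derive1 eta * phi) x)).
  apply: (@locally_integrableM_test _ _ (- M) M) => //; first exact: smoothM.
  by move=> x xM; rewrite !fctE eta'0// mul0r.
have i2 : mu.-integrable setT (EFin \o (fun x => f x * (eta * derive1 phi) x)).
  apply: (@locally_integrableM_test _ _ (- M) M) => //; first exact: smoothM.
  by move=> x xM; rewrite !fctE eta0// mul0r.
have i3 : mu.-integrable setT (EFin \o (fun x => g x * (eta * phi) x)).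
  exact: (@locally_integrableM_test _ _ (- M) M).
transitivity (\int[mu]_x (f x * (derive1 eta * phi) x)).
  by apply: eq_Rintegral => x _; rewrite !fctE; ring.
transitivity (- (\int[mu]_x (f x * (eta * derive1 phi) x) + \int[mu]_x (g x * (eta * phi) x))); last first.
  congr (- _); rewrite -RintegralD//; apply: eq_Rintegral => x _; rewrite !fctE; ring.
rewrite opprD -E addrC; apply/eqP; rewrite eq_sym subr_eq; apply/eqP.
rewrite -RintegralD//; apply: eq_Rintegral => x _.
by rewrite derive1M_smooth// !fctE; ring.
Qed.

(** The weak derivative g of f is tested against phi', so that both hypotheses express the integral
    of f phi''. *)
Lemma weak_derivative2 f g h : weak_derivative 1 f g -> weak_derivative 2 f h ->
  weak_derivative 1 g h.
Proof.
move=> [lf lg Hg] [_ lh Hh]; split => // phi tphi.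
have [M M0 phi0] := test_function_bounded tphi; have [sphi _ _] := tphi.
have tphi' : test_function setT (derive1 phi).
  apply: (@test_function_itv _ _ _ (- M) M) => //; first exact: smooth_derive1.
  by move=> x; exact: derive1_itv0.
have := Hg _ tphi'; have := Hh _ tphi.
rewrite expr1 sqrrN expr1n !mul1r !mulN1r => <- E.
by apply/eqP; rewrite -eqr_oppLR -E.
Qed.

(* Integrated form of (phi u)' u' + phi u u'' = (phi u u')'. *)
Lemma weak_energy_identity u ux uxx phi M : 0 < M -> smooth phi ->
  (forall x, x \notin `[- M, M] -> phi x = 0) ->
  weak_derivative 1 u ux -> weak_derivative 2 u uxx ->
  \int[mu]_x ((derive1 phi x * u x + phi x * ux x) * ux x) = - \int[mu]_x (uxx x * (phi x * u x)).
Proof.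
move=> M0 sphi phi0 d1 d2.
apply: weak_by_parts M0 (weak_derivativeM sphi d1) (weak_derivative2 d1 d2) _ _.
- by move=> x xM; rewrite phi0// mul0r.
- by move=> x xM; rewrite phi0// (derive1_itv0 phi0)// !mul0r addr0.
Qed.

End weak_products.

(** * Essential bounds *)

Section Linfty_bounds.
Context {R : realType}.
Local Notation mu := (@lebesgue_measure R).
Implicit Types (f g : R -> R) (D : set R) (K M : R).

(** The norm of exponent +oo is an essential supremum only when the whole space has positive
    measure; this fact selects that branch. *)
Lemma lebesgue_measureT_gt0 : (0 < mu setT)%E.
Proof.
have : (mu `[0%R, 1%R] <= mu setT)%E by apply: le_measure; rewrite ?inE.
by rewrite lebesgue_measure_itv /= lte_fin ltr01 oppr0 adde0; apply: lt_le_trans; rewrite lte_fin.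
Qed.

Lemma Linfty_normE D f : Linfty_norm mu D f = ess_sup mu (fun x => `|(f \_ D) x|%:E)%E.
Proof. by rewrite /Linfty_norm unlock /= lebesgue_measureT_gt0. Qed.

Lemma Linfty_norm_ge0 D f : (0 <= Linfty_norm mu D f)%E.
Proof. exact: Lnorm_ge0. Qed.

(** The sign of K accounts for the points outside D, where the restricted function is 0. *)
Lemma Linfty_normP D f K : 0 <= K ->
  (Linfty_norm mu D f <= K%:E)%E <-> {ae mu, forall x, D x -> `|f x| <= K}.
Proof.
move=> K0; rewrite Linfty_normE; split.
- move=> /ess_supP; apply: ae_imp => x; rewrite lee_fin patchE => fK Dx.
  by rewrite mem_set in fK.
- move=> fK; apply/ess_supP; move: fK; apply: ae_imp => x fK; rewrite lee_fin patchE.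
  by case: ifPn; rewrite ?normr0// inE => /fK.
Qed.

Lemma Linfty_norm_lty D f : (Linfty_norm mu D f < +oo)%E ->
  {ae mu, forall x, D x -> `|f x| <= fine (Linfty_norm mu D f)}.
Proof.
move=> foo; have f0 := Linfty_norm_ge0 D f.
by apply/Linfty_normP; [exact: fine_ge0|rewrite fineK// ge0_fin_numE].
Qed.

(** For r >= 0, the norm at t exceeds r exactly when the section at t of {|G| > r} has nonzero
    measure, and the measure of sections is a measurable function of t. *)
Lemma measurable_Linfty_norm (G : R * R -> R) : measurable_fun setT G ->
  measurable_fun setT (fun t => Linfty_norm mu setT (fun x => G (t, x))).
Proof.
move=> mG; apply: (measurability _ (ErealGenOInfty.measurableE R)) => //.
move=> _ -[_ [r ->] <-]; rewrite setTI.
pose A := [set z : R * R | r < `|G z|].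
have mA : measurable A.
  have mn : measurable_fun setT (fun z : R * R => `|G z|) by exact: measurableT_comp.
  have mr : measurable_fun setT (fun z : R * R => r < `|G z|) by exact: measurable_fun_ltr.
  by have := mr measurableT [set true] I; rewrite setTI.
have [r0|r0] := ltP r 0.
  rewrite (_ : _ @^-1` _ = setT)//; apply/seteqP; split => // t _ /=.
  by rewrite in_itv /= andbT; apply: lt_le_trans (Linfty_norm_ge0 _ _); rewrite lte_fin.
rewrite (_ : _ @^-1` _ = ~` ((fun t => mu (xsection A t)) @^-1` [set 0%E])).
  apply: measurableC; rewrite -[X in measurable X]setTI.
  by apply: (measurable_fun_xsection mu mA).
apply/seteqP; split => t /=; rewrite in_itv /= andbT ltNge.
- move=> /negP H A0; apply: H; apply/Linfty_normP => //.
  exists (xsection A t); split => //; first exact: measurable_xsection.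
  move=> x /= Hx; apply/xsectionP => /=; rewrite /A /=.
  by rewrite ltNge; apply/negP => Gr; apply: Hx.
- move=> H; apply/negP => /(Linfty_normP _ _ r0) [N [mN N0 HN]]; apply: H.
  apply/eqP; rewrite eq_le measure_ge0 andbT -N0 le_measure ?inE//.
    exact: measurable_xsection.
  move=> x /xsectionP; rewrite /A /= => Gr; apply: HN => /= /(_ I).
  by rewrite leNgt Gr.
Qed.

End Linfty_bounds.

(** * Uniform bounds from continuity in time *)

Section W1oo_continuity.
Context {R : realType}.
Local Notation mu := (@lebesgue_measure R).
Variables (T : R) (u ux : R -> R -> R).
Hypothesis uC : C_W1oo_loc T u ux.
Implicit Types (s t e M K x : R).

Lemma W1oo_near s M e : 0 <= s < T -> 0 < e ->
  \forall t \near within `[0, T[ (nbhs s),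
    {ae mu, forall x, x \in `[- M, M] -> `|u t x - u s x| <= e /\ `|ux t x - ux s x| <= e}.
Proof.
move=> sT e0; have [_ _ /(_ s M sT) H] := uC.
have : \forall t \near within `[0, T[ (nbhs s),
    (W1oo_norm M (u t \- u s)%R (ux t \- ux s)%R < e%:E)%E.
  by apply: (H [set y | (y < e%:E)%E]); apply: open_ereal_lt'; rewrite lte_fin.
apply: filterS => t; rewrite /W1oo_norm => He.
have H1 : {ae mu, forall x, x \in `[- M, M] -> `|u t x - u s x| <= e}.
  apply/(Linfty_normP _ (u t \- u s)); first exact: ltW.
  by apply: le_trans (ltW He); rewrite leeDl// Linfty_norm_ge0.
have H2 : {ae mu, forall x, x \in `[- M, M] -> `|ux t x - ux s x| <= e}.
  apply/(Linfty_normP _ (ux t \- ux s)); first exact: ltW.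
  by apply: le_trans (ltW He); rewrite leeDr// Linfty_norm_ge0.
by apply: ae_imp (ae_and H1 H2) => x [h1 h2] xM; split; [exact: h1|exact: h2].
Qed.

(** Near each time s, the bound at s plus 1 is valid. Compactness of [0, T'] makes it uniform: the
    filter +oo on K stands for the maximum over a finite subcover. *)
Lemma W1oo_bounded T' M : T' < T ->
  exists2 K, 0 < K & forall t, 0 <= t <= T' ->
    {ae mu, forall x, x \in `[- M, M] -> `|u t x| <= K /\ `|ux t x| <= K}.
Proof.
move=> T'T.
have := (@compact_near_coveringP _ _).1 (@segment_compact R 0 T') R +oo
  (fun K t => 0 <= t <= T' -> {ae mu, forall x, x \in `[- M, M] -> `|u t x| <= K /\ `|ux t x| <= K}).
case.
- move=> s; rewrite /= in_itv /= => /andP[s0 sT'].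
  have sT : 0 <= s < T by rewrite s0 (le_lt_trans sT').
  have [_ /(_ s sT)[_ [_ /(_ M)[[_ /Linfty_norm_lty H1] [_ /Linfty_norm_lty H2]]]] _] := uC.
  set k1 := fine _ in H1; set k2 := fine _ in H2.
  have := W1oo_near M sT ltr01; rewrite near_withinE => Hnear.
  near=> t K.
  have K1 : 1 + k1 <= K by near: K; apply: nbhs_pinfty_ge; exact: num_real.
  have K2 : 1 + k2 <= K by near: K; apply: nbhs_pinfty_ge; exact: num_real.
  move=> tT'; have /andP[t0 tT''] := tT'.
  have tT : t \in `[0, T[ by rewrite in_itv /= t0 (le_lt_trans tT'').
  have H3 : {ae mu, forall x, x \in `[- M, M] -> `|u t x - u s x| <= 1 /\ `|ux t x - ux s x| <= 1}.
    by move: tT; near: t; exact: Hnear.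
  apply: ae_imp (ae_and (ae_and H1 H2) H3) => x [[h1 h2] h3] xM.
  have [h4 h5] := h3 xM; split.
  + rewrite -(subrK (u s x) (u t x)); apply: le_trans (ler_normD _ _) _.
    exact: le_trans (lerD h4 (h1 xM)) K1.
  + rewrite -(subrK (ux s x) (ux t x)); apply: le_trans (ler_normD _ _) _.
    exact: le_trans (lerD h5 (h2 xM)) K2.
- move=> k [_ Hk]; exists (Num.max 1 (k + 1)); first by rewrite lt_max ltr01.
  move=> t tT'; apply: Hk => //; by rewrite lt_max ltrDl ltr01 orbT.
Unshelve. all: by end_near. Qed.

End W1oo_continuity.

(** * Separated test functions *)

Section separated_test_functions.
Context {R : realType}.
Local Notation mu := (@lebesgue_measure R).
Implicit Types (t x a b M K : R).

(** The bound is given for almost every x at each t, not almost everywhere in the plane, so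
    integrability is checked through the iterated integral. *)
Lemma box_integrable (H : R * R -> R) a b M K : measurable_fun setT H ->
  (forall t x, t \notin `[a, b] -> H (t, x) = 0) ->
  (forall t x, x \notin `[- M, M] -> H (t, x) = 0) ->
  (forall t, t \in `[a, b] -> {ae mu, forall x, x \in `[- M, M] -> `|H (t, x)| <= K}) ->
  (forall t, mu.-integrable setT (fun x => (H (t, x))%:E)) /\
  (mu \x mu)%E.-integrable setT (EFin \o H).
Proof.
move=> mH Ht Hx HK.
have mHt t : measurable_fun setT (fun x => H (t, x)).
  by apply: measurableT_comp mH _; exact: measurable_pair1.
have E t : (fun x => (H (t, x))%:E) = (EFin \o (fun x => H (t, x))) \_ `[- M, M].
  apply/funext => x; rewrite patchE mem_setE; case: ifPn => // /(Hx t) -> //.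
have moo : (mu `[(- M)%R, M] < +oo)%E by apply: compact_finite_measure; exact: segment_compact.
have it t : mu.-integrable setT (fun x => (H (t, x))%:E).
  rewrite E; apply/integrable_restrict => //; rewrite setTI.
  have [tab|tab] := boolP (t \in `[a, b]).
    by apply: (ae_bounded_integrable (K := K)) => //; [apply: measurable_funTS; exact: mHt|exact: HK].
  apply: (ae_bounded_integrable (K := 0)) => //; first by apply: measurable_funTS; exact: mHt.
  by apply: aeW => x _; rewrite Ht// normr0.
split=> //.
apply/integrable12ltyP; first exact/measurable_EFinP.
have K0 t : t \in `[a, b] -> (\int[mu]_x `|(EFin \o H) (t, x)| <= `|K|%:E * mu `[(- M)%R, M])%E.
  move=> tab; rewrite -integral_cst//.
  rewrite (_ : (fun x => `|(EFin \o H) (t, x)|%E) = (fun x => `|H (t, x)|%:E) \_ `[- M, M]); last first.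
    apply/funext => x; rewrite patchE mem_setE; case: ifPn => // /(Hx t) /= -> //.
    by rewrite normr0.
  rewrite -integral_mkcond; apply: ae_ge0_le_integral => //.
  - apply/measurable_EFinP; apply: measurable_funTS.
    by apply: measurableT_comp; [exact: normr_measurable|exact: mHt].
  - by move=> x _; rewrite lee_fin.
  - by apply: ae_imp (HK t tab) => x HKx xM; rewrite lee_fin (le_trans (HKx xM))// ler_norm.
have mF : measurable_fun setT (fun t => \int[mu]_x `|(EFin \o H) (t, x)|)%E.
  apply: (@measurable_fun_fubini_tonelli_F _ _ _ _ R mu (abse \o (EFin \o H))); last first.
    by move=> z; rewrite abse_ge0.
  by apply: measurableT_comp => //; exact/measurable_EFinP.
rewrite (_ : (fun t => _) = (fun t => \int[mu]_x `|(EFin \o H) (t, x)|)%E \_ `[a, b]); last first.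
  apply/funext => t; rewrite patchE mem_setE; case: ifPn => // tab.
  by apply: integral0_eq => x _ /=; rewrite Ht// normr0.
rewrite -integral_mkcond.
apply: (@le_lt_trans _ _ (\int[mu]_(t in `[a, b]) (`|K|%:E * mu `[(- M)%R, M]))%E).
  apply: ge0_le_integral => //.
  - by move=> t _; exact: integral_ge0.
  - exact: measurable_funTS.
rewrite integral_cst// lte_mul_pinfty//.
- by rewrite mule_ge0.
- by rewrite fin_numM// ge0_fin_numE.
- by apply: compact_finite_measure; exact: segment_compact.
Qed.

End separated_test_functions.

(** * Evolution of the moments *)

Section separated_equation.
Context {R : realType}.
Local Notation mu := (@lebesgue_measure R).
Variables (T : R) (u0 : R -> R) (u ux : R -> R -> R) (phi : R -> R) (M : R).
Hypothesis uC : C_W1oo_loc T u ux.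
Hypothesis mu_u : measurable_fun (`[0, T[ `*` setT) (fun z : R * R => u z.1 z.2).
Hypothesis weak_eq : forall (psi : R * R -> R) (w : R -> R -> R),
  test_function [set z | z.1 < T] psi ->
  is_dx 1 `[0, T[ (fun t x => psi (t, x) * u t x) w ->
  \int[mu]_x (u0 x * psi (0, x)) +
  \int[(mu \x mu)%E]_(z in `[0, T[ `*` [set: R])
    (u z.1 z.2 * 'D_(1, 0) psi z - 2^-1 * w z.1 z.2 * ux z.1 z.2) = 0.
Hypothesis cu0 : continuous u0.
Hypothesis sphi : smooth phi.
Hypothesis phi0 : forall x, x \notin `[- M, M] -> phi x = 0.
Implicit Types (t x b a : R) (th : R -> R).

Definition moment t := \int[mu]_x (u t x * phi x).

(** The derivative of phi u is expanded by the product rule, as the weak equation delivers it; the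
    second derivative of u enters only in [flux_bound]. *)
Definition flux t :=
  - 2^-1 * \int[mu]_x ((derive1 phi x * u t x + phi x * ux t x) * ux t x).

Let tensor th (z : R * R) : R := th z.1 * phi z.2.

Lemma u0phi_integrable : mu.-integrable setT (EFin \o (fun x => u0 x * phi x)).
Proof.
rewrite (_ : EFin \o _ = (EFin \o (fun x => u0 x * phi x)) \_ `[- M, M]); last first.
  apply/funext => x; rewrite patchE mem_setE; case: ifPn => // xM /=.
  by rewrite phi0// mulr0.
apply/integrable_restrict => //; rewrite setTI.
apply: continuous_compact_integrable; first exact: segment_compact.
by apply: continuous_subspaceT => x; apply: cvgM; [exact: cu0|exact: smooth_continuous].
Qed.

Lemma smooth_fst th : smooth th -> smooth (th \o (fst : R * R -> R)).
Proof.
move=> sth; apply: (smooth_comp_affine (l := fst)) => //.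
by move=> x; exact: cvg_fst.
Qed.

Lemma smooth_snd th : smooth th -> smooth (th \o (snd : R * R -> R)).
Proof.
move=> sth; apply: (smooth_comp_affine (l := snd)) => //.
by move=> x; exact: cvg_snd.
Qed.

Lemma measurable_smooth_fst (g : R -> R) D :
  smooth g -> measurable_fun D (fun z : R * R => g z.1).
Proof.
move=> sg; apply: measurable_funTS.
have mg := continuous_measurable_fun (smooth_continuous sg).
by apply: (measurableT_comp mg); exact: measurable_fst.
Qed.

Lemma measurable_smooth_snd (g : R -> R) D :
  smooth g -> measurable_fun D (fun z : R * R => g z.2).
Proof.
move=> sg; apply: measurable_funTS.
have mg := continuous_measurable_fun (smooth_continuous sg).
by apply: (measurableT_comp mg); exact: measurable_snd.
Qed.

(** Only b is constrained: a may be negative, so th need not vanish at time 0, which is how the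
    initial datum becomes visible. *)
Lemma tensor_test th a b : b < T -> smooth th ->
  (forall t, t \notin `[a, b] -> th t = 0) -> test_function [set z | z.1 < T] (tensor th).
Proof.
move=> bT sth th0.
have cF : compact (`[a, b] `*` `[- M, M] : set (R * R)).
  by apply: compact_setX; exact: segment_compact.
have clF : closed (`[a, b] `*` `[- M, M] : set (R * R)).
  by apply: compact_closed => //; exact: norm_hausdorff.
have sF : supp (tensor th) `<=` `[a, b] `*` `[- M, M].
  apply: supp_sub_closed => // -[t x] /= H; rewrite /tensor /=.
  have [tab|tab] := boolP (t \in `[a, b]); last by rewrite th0// mul0r.
  by rewrite phi0 ?mulr0//; apply/negP => xM; apply: H.
split.
- exact: smoothM (smooth_fst sth) (smooth_snd sphi).
- by apply: subclosed_compact sF => //; exact: closed_closure.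
- apply: subset_trans sF _ => -[t x] [/= + _]; rewrite in_itv /= => /andP[_ tb].
  exact: le_lt_trans tb bT.
Qed.

Lemma tensor_derive th (z : R * R) : smooth th ->
  'D_(1, 0) (tensor th) z = derive1 th z.1 * phi z.2.
Proof.
move=> sth.
have -> : tensor th = (th \o (fst : R * R -> R)) * (phi \o (snd : R * R -> R)) by [].
rewrite deriveM; [|exact/smooth_derivable/smooth_fst|exact/smooth_derivable/smooth_snd].
rewrite (@derive_comp_affine _ _ th fst fst)// (@derive_comp_affine _ _ phi snd snd)//=.
by rewrite derive0 scaler0 add0r derive1E /GRing.scale /= mulrC.
Qed.

Let w th t x := th t * (derive1 phi x * u t x + phi x * ux t x).

Lemma tensor_is_dx th : smooth th ->
  is_dx 1 `[0, T[ (fun t x => tensor th (t, x) * u t x) (w th).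
Proof.
move=> sth; have [mux Hux _] := uC.
split.
- apply: measurable_funM; first exact: measurable_smooth_fst.
  by apply: measurable_funD; apply: measurable_funM => //; apply: measurable_smooth_snd => //; exact: smooth_derive1.
- apply: aeW => t tT; have [_ [dux _]] := Hux t tT.
  have := weak_derivativeM (smoothM (smooth_cst (th t)) sphi) dux.
  rewrite derive1M_smooth//; last exact: smooth_cst.
  rewrite (_ : (fun x => _ * u t x) = (fun x => tensor th (t, x) * u t x))//.
  rewrite (_ : (fun x => _ + _) = w th t)//.
  apply/funext => x; rewrite /w !fctE.
  by rewrite derive1E derive_cst; ring.
Qed.

Section box.
Variable b : R.
Hypothesis b0 : 0 < b.
Hypothesis bT : b < T.

Let Q : set (R * R) := `[0, b] `*` setT.
(** The integrands of [moment] and [flux], cut off to times in [0, b], where the bounds of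
    [W1oo_bounded] are uniform. *)
Let Ha := (fun z : R * R => u z.1 z.2 * phi z.2) \_ Q.
Let Hb := (fun z : R * R =>
  - 2^-1 * ((derive1 phi z.2 * u z.1 z.2 + phi z.2 * ux z.1 z.2) * ux z.1 z.2)) \_ Q.

Let mQ : measurable Q. Proof. exact: measurableX. Qed.

Let mQT : measurable (`[0, T[ `*` setT : set (R * R)). Proof. exact: measurableX. Qed.

Let QT : Q `<=` `[0, T[ `*` setT.
Proof.
by move=> z [/= + _]; rewrite in_itv /= => /andP[z0 zb]; split => //=; rewrite in_itv /= z0 (le_lt_trans zb).
Qed.

Let inQ t x : ((t, x) \in Q) = (t \in `[0, b]).
Proof. by apply/idP/idP => [|tb]; rewrite inE /Q /=; [case|split]. Qed.

Let mHa : measurable_fun setT Ha.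
Proof.
apply: (proj1 (measurable_restrictT _ mQ)); apply: measurable_funM; last exact: measurable_smooth_snd.
exact: measurable_funS QT mu_u.
Qed.

Let mHb : measurable_fun setT Hb.
Proof.
have [mux _ _] := uC.
have mu' : measurable_fun Q (fun z => u z.1 z.2) by exact: measurable_funS QT mu_u.
have mux' : measurable_fun Q (fun z => ux z.1 z.2) by exact: measurable_funS QT mux.
apply: (proj1 (measurable_restrictT _ mQ)); apply: measurable_funM; first exact: measurable_cst.
apply: measurable_funM => //.
by apply: measurable_funD; apply: measurable_funM => //; apply: measurable_smooth_snd => //; exact: smooth_derive1.
Qed.

Let Ha_t t x : t \notin `[0, b] -> Ha (t, x) = 0.
Proof. by move=> tb; rewrite /Ha patchE inQ (negbTE tb). Qed.

Let Hb_t t x : t \notin `[0, b] -> Hb (t, x) = 0.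
Proof. by move=> tb; rewrite /Hb patchE inQ (negbTE tb). Qed.

Let Ha_x t x : x \notin `[- M, M] -> Ha (t, x) = 0.
Proof. by move=> xM; rewrite /Ha patchE inQ; case: ifP => // _; rewrite /= phi0// mulr0. Qed.

Let Hb_x t x : x \notin `[- M, M] -> Hb (t, x) = 0.
Proof.
move=> xM; rewrite /Hb patchE inQ; case: ifP => // _.
by rewrite /= phi0// (derive1_itv0 phi0)// !mul0r addr0 mul0r mulr0.
Qed.

Let HaE t : t \in `[0, b] -> forall x, Ha (t, x) = u t x * phi x.
Proof. by move=> tb x; rewrite /Ha patchE inQ tb. Qed.

Let HbE t : t \in `[0, b] -> forall x, Hb (t, x) =
  - 2^-1 * ((derive1 phi x * u t x + phi x * ux t x) * ux t x).
Proof. by move=> tb x; rewrite /Hb patchE inQ tb. Qed.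

Let Ha_bound : exists K, forall t, t \in `[0, b] ->
  {ae mu, forall x, x \in `[- M, M] -> `|Ha (t, x)| <= K}.
Proof.
have [K K0 HK] := W1oo_bounded uC M bT.
have [C HC] := @smooth_bounded _ phi (- M) M sphi.
exists (K * C) => t tb; apply: ae_imp (HK t tb) => x Kx xM; have [Kx1 _] := Kx xM.
by rewrite HaE// normrM ler_pM// HC.
Qed.

Let Hb_bound : exists K, forall t, t \in `[0, b] ->
  {ae mu, forall x, x \in `[- M, M] -> `|Hb (t, x)| <= K}.
Proof.
have [K K0 HK] := W1oo_bounded uC M bT.
have [C HC] := @smooth_bounded _ phi (- M) M sphi.
have [C' HC'] := @smooth_bounded _ (derive1 phi) (- M) M (smooth_derive1 sphi).
exists (2^-1 * ((C' * K + C * K) * K)) => t tb; apply: ae_imp (HK t tb) => x Kx xM.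
have [Kx1 Kx2] := Kx xM.
have n2 : `|- 2^-1| = 2^-1 :> R by rewrite normrN gtr0_norm.
rewrite HbE// normrM n2 ler_wpM2l//.
rewrite normrM ler_pM//; apply: le_trans (ler_normD _ _) _.
by rewrite !normrM lerD// ler_pM// ?HC ?HC'.
Qed.

Let Ha_integrable : (forall t, mu.-integrable setT (fun x => (Ha (t, x))%:E)) /\
  (mu \x mu)%E.-integrable setT (EFin \o Ha).
Proof. by have [K HK] := Ha_bound; exact: box_integrable mHa Ha_t Ha_x HK. Qed.

Let Hb_integrable : (forall t, mu.-integrable setT (fun x => (Hb (t, x))%:E)) /\
  (mu \x mu)%E.-integrable setT (EFin \o Hb).
Proof. by have [K HK] := Hb_bound; exact: box_integrable mHb Hb_t Hb_x HK. Qed.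

Let momentE t : t \in `[0, b] -> (\int[mu]_x (Ha (t, x))%:E = (moment t)%:E)%E.
Proof.
move=> tb; rewrite /moment -(funext (HaE tb)) /Rintegral fineK//.
by apply: integrable_fin_num => //; have [+ _] := Ha_integrable; apply.
Qed.

Let fluxE t : t \in `[0, b] -> (\int[mu]_x (Hb (t, x))%:E = (flux t)%:E)%E.
Proof.
move=> tb; have [iH _] := Hb_integrable.
rewrite -[LHS]fineK; last exact: integrable_fin_num.
congr EFin; rewrite /flux; transitivity (\int[mu]_x Hb (t, x)) => //.
(* The known integrability is that of [Hb], so the factor is moved across the integral of [Hb]
   itself. *)
transitivity (- 2^-1 * \int[mu]_x (- 2 * Hb (t, x))).
  by rewrite RintegralZl ?iH//; field.
congr (_ * _); apply: eq_Rintegral => x _.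
by rewrite HbE//; field.
Qed.

Let box_fubini (H : R * R -> R) (h : R -> R) :
  (forall t x, t \notin `[0, b] -> H (t, x) = 0) ->
  (mu \x mu)%E.-integrable setT (EFin \o H) ->
  (forall t, t \in `[0, b] -> (\int[mu]_x (H (t, x))%:E = (h t)%:E)%E) ->
  mu.-integrable `[0, b] (EFin \o h) /\
  \int[(mu \x mu)%E]_z H z = \int[mu]_(t in `[0, b]) h t.
Proof.
move=> H0 iH Hh.
have E : (fun t => \int[mu]_x (EFin \o H) (t, x))%E = (EFin \o h) \_ `[0, b].
  apply/funext => t; rewrite patchE mem_setE; case: ifPn => tb; first exact: Hh.
  by apply: integral0_eq => x _ /=; rewrite H0.
split.
  have := integrable_fubini_F iH; rewrite /fubini_F E => /integrable_restrict.
  by rewrite setTI; apply.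
rewrite /Rintegral -integral12_prod_meas1// /fubini_F E.
by rewrite -integral_mkcond.
Qed.

Lemma moment_integrable : mu.-integrable `[0, b] (EFin \o moment).
Proof. by have [] := box_fubini Ha_t (proj2 Ha_integrable) momentE. Qed.

Lemma flux_integrable : mu.-integrable `[0, b] (EFin \o flux).
Proof. by have [] := box_fubini Hb_t (proj2 Hb_integrable) fluxE. Qed.

(** The weak equation for th(t) phi(x), integrated in x inside. Since th vanishes after b, the time
    integral over [0, T[ reduces to [0, b]. *)
Lemma separated_equation th a : smooth th -> (forall t, t \notin `[a, b] -> th t = 0) ->
  th 0 * \int[mu]_x (u0 x * phi x) +
  \int[mu]_(t in `[0, b]) (moment t * derive1 th t + flux t * th t) = 0.
Proof.
move=> sth th0.
have th'0 t : t \notin `[a, b] -> derive1 th t = 0 by exact: derive1_itv0.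
have E := weak_eq (tensor_test bT sth th0) (tensor_is_dx sth).
rewrite -[RHS]E; congr (_ + _).
  rewrite -RintegralZl//; last exact: u0phi_integrable.
  by apply: eq_Rintegral => x _; rewrite /tensor /=; ring.
pose H (z : R * R) := derive1 th z.1 * Ha z + th z.1 * Hb z.
have H_t t x : t \notin `[0, b] -> H (t, x) = 0.
  by move=> tb; rewrite /H Ha_t// Hb_t// !mulr0 addr0.
have H_x t x : x \notin `[- M, M] -> H (t, x) = 0.
  by move=> xM; rewrite /H Ha_x// Hb_x// !mulr0 addr0.
have mH : measurable_fun setT H.
  apply: measurable_funD; apply: measurable_funM => //; apply: measurable_smooth_fst => //.
  exact: smooth_derive1.
have iH : (mu \x mu)%E.-integrable setT (EFin \o H).
  have [Ka HKa] := Ha_bound; have [Kb HKb] := Hb_bound.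
  have [C HC] := @smooth_bounded _ th 0 b sth.
  have [C' HC'] := @smooth_bounded _ (derive1 th) 0 b (smooth_derive1 sth).
  apply: (proj2 (@box_integrable _ H 0 b M (C' * Ka + C * Kb) mH H_t H_x _)) => t tb.
  apply: ae_imp (ae_and (HKa t tb) (HKb t tb)) => x [ha hb] xM.
  apply: le_trans (ler_normD _ _) _; rewrite !normrM lerD// ler_pM//=.
  - exact: HC'.
  - exact: ha.
  - exact: HC.
  - exact: hb.
have Hh t : t \in `[0, b] ->
    (\int[mu]_x (H (t, x))%:E = (moment t * derive1 th t + flux t * th t)%:E)%E.
  move=> tb; have [ia _] := Ha_integrable; have [ib _] := Hb_integrable.
  rewrite (_ : (fun x => _) = (fun x => (derive1 th t)%:E * (Ha (t, x))%:E + (th t)%:E * (Hb (t, x))%:E)%E)//.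
  rewrite integralD//; [|exact: integrableZl|exact: integrableZl].
  rewrite !integralZl// momentE// fluxE// -!EFinM -EFinD.
  by congr EFin; ring.
have [_ <-] := box_fubini H_t iH Hh.
rewrite [RHS]Rintegral_mkcond; apply: eq_Rintegral => -[t x] _.
rewrite patchE /H /=.
have [tb|tb] := boolP (t \in `[0, b]).
  have -> : ((t, x) \in `[0, T[ `*` [set: R]) by rewrite inE; apply: QT; rewrite -inE inQ.
  by rewrite HaE// HbE// tensor_derive// /w /=; field.
(* What remains is b < t < T, where th and its derivative are both zero. *)
rewrite Ha_t// Hb_t// !mulr0 addr0.
case: ifPn => //; rewrite inE /= in_itv /= => -[/andP[t0 tT] _].
have tab : t \notin `[a, b].
  by move: tb; rewrite !in_itv /= t0 /= => H1; rewrite negb_and H1 orbT.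
by rewrite tensor_derive// /w /= th'0// th0//; ring.
Qed.

Lemma moment_continuous : {within `[0, b], continuous moment}.
Proof.
apply/subspace_continuousP => s; rewrite /= in_itv /= => /andP[s0 sb].
have sT : 0 <= s < T by rewrite s0 (le_lt_trans sb).
have [C HC] := @smooth_bounded _ phi (- M) M sphi.
apply/cvgrPdist_le => e e0.
(* A deviation d of u changes the moment by at most d |C| 2M; the added 1 guards against a zero
   denominator. *)
pose d := e / (`|C| * (2 * `|M|) + 1).
have d0 : 0 < d by rewrite divr_gt0// ltr_wpDl// !mulr_ge0.
have := W1oo_near uC M sT d0; rewrite !near_withinE; apply: filterS => t Ht tb.
have tT : t \in `[0, T[.
  by move: tb; rewrite /= !in_itv /= => /andP[-> tb]; exact: le_lt_trans tb bT.
have sb' : s \in `[0, b] by rewrite in_itv /= s0 sb.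
have [ia _] := Ha_integrable.
have ips : mu.-integrable setT (EFin \o (fun x => u s x * phi x)).
  by have := ia s; rewrite (_ : (fun x => _) = EFin \o (fun x => u s x * phi x))//; apply/funext => x /=; rewrite HaE.
have ipt : mu.-integrable setT (EFin \o (fun x => u t x * phi x)).
  by have := ia t; rewrite (_ : (fun x => _) = EFin \o (fun x => u t x * phi x))//; apply/funext => x /=; rewrite HaE.
rewrite /moment -RintegralB//.
have ist : mu.-integrable setT (EFin \o (fun x => u s x * phi x - u t x * phi x)).
  exact: (integrableB _ ips ipt).
(* For M < 0 the interval is empty and phi is identically 0. *)
have [M0|M0] := leP 0 M; last first.
  rewrite (@eq_Rintegral _ _ _ mu _ (cst 0)) ?Rintegral_cst ?mul0r ?normr0 ?ltW//.
  by move=> x _; rewrite phi0 ?mulr0 ?subrr// in_itv /= -ler_norml -ltNge (lt_le_trans M0).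
apply: le_trans (le_normr_Rintegral _ ist) _ => //.
rewrite (@Rintegral_restrict _ _ _ mu setT `[- M, M])//; last first.
  by move=> x _ xM; rewrite phi0 ?mulr0 ?subrr ?normr0//; exact/negP.
have MM : - M <= M by rewrite (le_trans _ M0)// oppr_le0.
apply: (@le_trans _ _ (\int[mu]_(x in `[- M, M]) (d * `|C|))).
  apply: ae_le_Rintegral => //.
  - by apply: integrableS (integrable_normr ist).
  - by apply: smooth_integrable; exact: smooth_cst.
  - apply: ae_imp (Ht tT) => x Hx xM; have [h _] := Hx xM.
    rewrite -mulrBl normrM distrC ler_pM//.
    by apply: le_trans (HC x xM) (ler_norm _).
rewrite Rintegral_cst_itv// /d.
have -> : M - - M = 2 * `|M| by rewrite (ger0_norm M0); ring.
pose k := `|C| * (2 * `|M|).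
have k0 : 0 <= k by rewrite !mulr_ge0.
suff H : e / (k + 1) * k <= e.
  by apply: le_trans H; rewrite -[leLHS]mulrA.
by rewrite mulrAC ler_pdivrMr ?ltr_wpDl//; apply: ler_wpM2l; rewrite ?lerDl ?ltW.
Qed.

Lemma moment_evolution t : t \in `[0, b] ->
  moment t = \int[mu]_x (u0 x * phi x) + \int[mu]_(s in `[0, t]) flux s.
Proof.
have mi := moment_integrable; have fi := flux_integrable.
(* Test functions of time vanishing outside [0, b] vanish at 0 by continuity, so the initial term
   drops out and [flux] is the weak time derivative of [moment]. *)
have [|c Hc] := weak_primitive b0 mi fi.
  move=> th sth th0; have := separated_equation sth th0.
  rewrite (continuous_itv_bound0l (smooth_continuous sth) th0) mul0r add0r.
  rewrite RintegralD//; [|exact/integrableM_smooth/smooth_derive1|exact: integrableM_smooth].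
  by move=> /eqP; rewrite addr_eq0 => /eqP.
have cP := parameterized_integral_continuous (ltW b0) fi.
(* Both sides are continuous in time, so the identity holds at every time. *)
have {}Hc : forall s, s \in `[0, b] -> moment s = c + \int[mu]_(y in `[0, s]) flux y.
  apply: (ae_eq_continuous b0 moment_continuous _ Hc).
  apply: (@within_continuousD _ _ _ _ (cst c)) => //.
  by apply: continuous_subspaceT => x; exact: cvg_cst.
suff -> : \int[mu]_x (u0 x * phi x) = c by exact: Hc.
(* This function is positive at 0 and zero at b: the equation retains the initial term, and
   comparison with the by-parts formula yields c. *)
pose th := cutoff (- 1) b 1; have sth : smooth th by exact: smooth_cutoff.
have th0 s : s \notin `[- 1, b] -> th s = 0 by exact: cutoff_notin.
have th00 : 0 < th 0 by apply: cutoff_gt0; rewrite ?b0 ?ltrN10.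
have thb : th b = 0 by apply: (@continuous_itv_bound0 _ th (- 1) b) => //; exact: smooth_continuous.
have := separated_equation sth th0.
rewrite RintegralD//; [|exact/integrableM_smooth/smooth_derive1|exact: integrableM_smooth].
have -> : \int[mu]_(s in `[0, b]) (moment s * derive1 th s) =
    - (c * th 0) - \int[mu]_(s in `[0, b]) (flux s * th s).
  transitivity (\int[mu]_(s in `[0, b]) (c * derive1 th s + derive1 th s * \int[mu]_(y in `[0, s]) flux y)).
    by apply: eq_Rintegral => s; rewrite mem_setE => sb; rewrite Hc//; ring.
  have ith := @smooth_integrable _ _ 0 b (smooth_derive1 sth).
  rewrite RintegralD//; last 2 first.
  - exact: (@integrableZl _ _ _ mu `[0, b] (measurable_itv _) c _ ith).
  - rewrite (_ : EFin \o _ = EFin \o (fun s => (\int[mu]_(y in `[0, s]) flux y) * derive1 th s)); last first.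
      by apply/funext => s /=; rewrite mulrC.
    by apply: integrableM_smooth; [exact: primitive_integrable|exact: smooth_derive1].
  rewrite RintegralZl// smooth_primitive_by_parts// thb mul0r sub0r.
  by rewrite smooth_FTC2 ?ltW// thb sub0r mulrN.
rewrite subrK => /eqP; rewrite subr_eq0 mulrC => /eqP/mulIf; apply.
by rewrite gt_eqF.
Qed.

End box.

End separated_equation.

(** * Gronwall's argument and comparison *)

Section comparison.
Context {R : realType}.
Local Notation mu := (@lebesgue_measure R).
Implicit Types (a b s t x K : R).

(* J stands for the integral over [s, t] of the growth rate: as it is at most
   1/2, the maximum of h on [s, t] is at most twice its value at either end. *)
Lemma gronwall_piece (h : R -> R) (J s t : R) : s <= t ->
  {within `[s, t], continuous h} -> J <= 2^-1 ->
  (forall s' t' K, s <= s' -> s' <= t' -> t' <= t ->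
     (forall r, r \in `[s', t'] -> h r <= K) -> 0 <= K -> `|h t' - h s'| <= K * J) ->
  (forall r, r \in `[s, t] -> 0 <= h r) ->
  h t <= 2 * h s /\ h s <= 2 * h t.
Proof.
move=> st ch J2 H h0.
have [c cst Hc] := EVT_max st ch.
have c0 := h0 _ cst; have /andP[sc ct] : s <= c <= t by move: cst; rewrite in_itv.
(* With the maximum h(c) as the bound K, h varies by at most h(c)/2 between c and either end, so
   both end values lie between h(c)/2 and h(c). *)
have KJ : h c * J <= h c / 2 by rewrite ler_wpM2l.
have H1 : `|h c - h s| <= h c / 2.
  apply: le_trans (H s c (h c) (lexx _) sc ct _ c0) KJ => r.
  by rewrite in_itv /= => /andP[sr rc]; apply: Hc; rewrite in_itv /= sr (le_trans rc).
have H2 : `|h t - h c| <= h c / 2.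
  apply: le_trans (H c t (h c) sc ct (lexx _) _ c0) KJ => r.
  by rewrite in_itv /= => /andP[cr rt]; apply: Hc; rewrite in_itv /= rt (le_trans sc).
have ht : h t <= h c by apply: Hc; rewrite in_itv /= st lexx.
have hs : h s <= h c by apply: Hc; rewrite in_itv /= lexx st.
by move: H1 H2; rewrite !ler_norml => /andP[? ?] /andP[? ?]; split; lra.
Qed.

Lemma lebesgue_itvcc_le s t : s <= t -> (mu `[s, t] <= (t - s)%:E)%E.
Proof.
by move=> st; rewrite lebesgue_measure_itv /= lte_fin; case: ifPn; rewrite // lee_fin subr_ge0.
Qed.

(** C is chosen before h: the same constant must serve the moments of all test functions. The
    increment hypothesis is an integral form of |h'| <= |n| h that asks for no derivative. *)
Lemma gronwall_chain (n : R -> R) b : 0 < b -> mu.-integrable `[0, b] (EFin \o n) ->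
  exists2 C, 0 < C & forall h : R -> R,
    {within `[0, b], continuous h} ->
    (forall r, r \in `[0, b] -> 0 <= h r) ->
    (forall s t K, 0 <= s -> s <= t -> t <= b ->
      (forall r, r \in `[s, t] -> h r <= K) -> 0 <= K ->
      `|h t - h s| <= K * \int[mu]_(r in `[s, t]) `|n r|) ->
    forall t, t \in `[0, b] -> h t <= C * h 0 /\ h 0 <= C * h t.
Proof.
move=> b0 ni.
pose nb := n \_ `[0, b].
have nbi : mu.-integrable setT (EFin \o nb).
  by rewrite /nb -restrict_EFin; apply/integrable_restrict => //; rewrite setTI.
have half0 : (0 < 2^-1 :> R) by rewrite invr_gt0.
(* Absolute continuity of the integral: sets of measure below d carry less than 1/2 of |n|. *)
have [d [d0 Hd]] := integral_normr_continuous nbi half0.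
(* Since k + 1 exceeds b / d, the k + 1 equal pieces of [0, b] are shorter than d. *)
pose k := Num.truncn (b / d); pose l := b / k.+1%:R.
have l0 : 0 < l by rewrite divr_gt0.
have ld : l < d.
  rewrite /l ltr_pdivrMr// -ltr_pdivrMl// mulrC.
  exact: truncnS_gt.
have small s t : 0 <= s -> s <= t -> t <= b -> t - s <= l ->
    \int[mu]_(r in `[s, t]) `|n r| <= 2^-1.
  move=> s0 st tb tsl; apply: ltW.
  rewrite (_ : \int[mu]_(r in `[s, t]) `|n r| = \int[mu]_(r in `[s, t]) `|nb r|).
    by apply: Hd => //; apply: le_lt_trans (lebesgue_itvcc_le st) _; rewrite lte_fin (le_lt_trans tsl).
  apply: eq_Rintegral => r; rewrite mem_setE in_itv /= => /andP[sr rt].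
  by rewrite /nb patchE mem_setE in_itv /= (le_trans s0 sr) (le_trans rt tb).
exists (2 ^+ k.+1); first by rewrite exprn_gt0.
move=> h ch h0 H t tb.
(* Each piece costs one factor 2, in both directions of time. *)
suff Hj j : forall t, t \in `[0, b] -> t <= j%:R * l ->
    h t <= 2 ^+ j * h 0 /\ h 0 <= 2 ^+ j * h t.
  apply: Hj => //; rewrite /l mulrC divfK//.
  by move: tb; rewrite in_itv => /andP[].
elim: j => [|j IH] {}t {}tb tj.
  move: tj tb; rewrite mul0r in_itv /= => t0 /andP[t0' _].
  have -> : t = 0 by apply/eqP; rewrite eq_le t0 t0'.
  by rewrite expr0 !mul1r.
have ht := h0 t tb.
have h00 : 0 <= h 0 by apply: h0; rewrite in_itv /= lexx ltW.
have [tj'|tj'] := leP t (j%:R * l).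
  have [h1 h2] := IH t tb tj'; rewrite exprS; split.
    by apply: le_trans h1 _; rewrite ler_wpM2r// ler_peMl// ?exprn_ge0// ler1n.
  by apply: le_trans h2 _; rewrite ler_wpM2r// ler_peMl// ?exprn_ge0// ler1n.
have /andP[t0 tb'] : 0 <= t <= b by move: tb; rewrite in_itv.
set s := j%:R * l in IH tj'.
have s0 : 0 <= s by rewrite mulr_ge0// ltW.
have sb : s \in `[0, b] by rewrite in_itv /= s0 (le_trans (ltW tj')).
have [h1 h2] := IH s sb (lexx _).
have tsl : t - s <= l by rewrite lerBlDr; move: tj; rewrite -natr1 mulrDl mul1r addrC.
have [||||h3 h4] := @gronwall_piece h (\int[mu]_(r in `[s, t]) `|n r|) s t (ltW tj').
- apply: continuous_subspaceW ch => r /=; rewrite !in_itv /= => /andP[sr rt].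
  by rewrite (le_trans s0 sr) (le_trans rt tb').
- by apply: small => //; exact: ltW.
- move=> s' t' K ss' st' tt' HK K0.
  apply: le_trans (H s' t' K (le_trans s0 ss') st' (le_trans tt' tb') HK K0) _.
  apply: ler_wpM2l => //.
  have inn x y : 0 <= x -> y <= b -> mu.-integrable `[x, y] (EFin \o (fun r => `|n r|)).
    move=> x0 yb; apply: integrable_normr; apply: integrableS ni => //.
    by apply: subset_itvScc; rewrite bnd_simp.
  have ss : `[s', t'] `<=` `[s, t] by apply: subset_itvScc; rewrite bnd_simp.
  rewrite [leLHS]Rintegral_mkcond [leRHS]Rintegral_mkcond; apply: le_Rintegral => //.
  - rewrite -restrict_EFin; apply/integrable_restrict => //; rewrite setTI.
    by apply: inn; [exact: le_trans s0 ss'|exact: le_trans tt' tb'].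
  - rewrite -restrict_EFin; apply/integrable_restrict => //; rewrite setTI.
    exact: inn.
  - move=> r _; rewrite !patchE; case: ifPn => [|_]; last by case: ifPn => _; [exact: normr_ge0|exact: lexx].
    by rewrite inE => /ss rst; rewrite mem_set.
- by move=> r; rewrite in_itv /= => /andP[sr rt]; apply: h0; rewrite in_itv /= (le_trans s0 sr) (le_trans rt tb').
- rewrite exprS -!mulrA; split.
    by apply: le_trans h3 _; rewrite ler_wpM2l.
  by apply: le_trans h2 _; rewrite mulrCA ler_wpM2l// exprn_ge0.
Qed.

(** If g(x) < 0, then g stays below g(x)/2 near x, and a bump of integral 1 supported there has
    moment at most g(x)/2 < 0. *)
Lemma ge0_test (g : R -> R) : continuous g ->
  (forall phi M, 0 < M -> smooth phi -> (forall x, 0 <= phi x) ->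
    (forall x, x \notin `[- M, M] -> phi x = 0) -> 0 <= \int[mu]_x (g x * phi x)) ->
  forall x, 0 <= g x.
Proof.
move=> cg Hg x; rewrite leNgt; apply/negP => gx.
have /nbhs_ballP[d /= d0 Hd] : \forall y \near x, g y < g x / 2.
  apply: (cvgr_lt (g x) (cg x)).
  by rewrite ltr_pdivlMr// mulr_natr mulr2n gtrDl.
have d2 : 0 < d / 2 by rewrite divr_gt0.
have ab : x - d / 2 < x + d / 2 by lra.
have [z [sz z0 zge Iz]] := exists_cutoff_integral1 ab.
pose M := `|x| + d.
have zM y : y \notin `[- M, M] -> z y = 0.
  move=> yM; apply: z0; apply: contra yM; rewrite !in_itv /= => /andP[y1 y2].
  have := ler_norm x; have := ler_norm (- x); rewrite normrN /M => ? ?.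
  by apply/andP; split; lra.
have M0 : 0 < M by rewrite ltr_wpDl.
have := Hg z M M0 sz zge zM.
rewrite (@Rintegral_restrict _ _ _ mu setT `[x - d / 2, x + d / 2])//; last first.
  by move=> y _ yab; rewrite z0 ?mulr0//; exact/negP.
apply/negP; rewrite -ltNge.
have gzi : mu.-integrable `[x - d / 2, x + d / 2] (EFin \o (fun y => g y * z y)).
  apply: integrableM_smooth => //; apply: continuous_compact_integrable; first exact: segment_compact.
  exact: continuous_subspaceT.
apply: (@le_lt_trans _ _ (\int[mu]_(y in `[x - d / 2, x + d / 2]) (g x / 2 * z y))).
  apply: le_Rintegral => //.
    by apply: (@integrableZl _ _ _ mu _ (measurable_itv _) (g x / 2) _ (@smooth_integrable _ z _ _ sz)).
  move=> y; rewrite /= in_itv /= => /andP[y1 y2]; rewrite ler_wpM2r//; apply: ltW.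
  by apply: Hd; rewrite /ball /= ltr_norml; apply/andP; split; lra.
rewrite RintegralZl//; last exact: smooth_integrable.
by rewrite Iz mulr1; lra.
Qed.

End comparison.

(** * Estimates for strong solutions *)

Section strong_solutions.
Context {R : realType}.
Local Notation mu := (@lebesgue_measure R).
Implicit Types (s t x b K M T : R).

Lemma flux_bound (u ux : R -> R -> R) (g phi : R -> R) t M K : 0 < M -> smooth phi ->
  (forall x, 0 <= phi x) -> (forall x, x \notin `[- M, M] -> phi x = 0) ->
  continuous (u t) -> (forall x, 0 <= u t x) ->
  weak_derivative 1 (u t) (ux t) -> weak_derivative 2 (u t) g ->
  {ae mu, forall x, `|g x| <= K} ->
  `|flux u ux phi t| <= 2^-1 * K * moment u phi t.
Proof.
move=> M0 sphi phi_ge0 phi0 cu u_ge0 d1 d2 gK.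
have [_ lg _] := d2; have cphi := smooth_continuous sphi.
have cpu : continuous (fun x => phi x * u t x).
  by move=> x; apply: cvgM; [exact: cphi|exact: cu].
have pu0 x : x \notin `[- M, M] -> phi x * u t x = 0 by move=> /phi0 ->; rewrite mul0r.
(* The minus sign of [flux] cancels that of the energy identity, leaving half the integral of g phi
   u. *)
rewrite /flux (weak_energy_identity M0 sphi phi0 d1 d2) mulrNN normrM gtr0_norm ?invr_gt0//.
rewrite -mulrA ler_wpM2l// /moment.
rewrite (@Rintegral_restrict _ _ _ mu setT `[- M, M])//; last first.
  by move=> x _ xM; rewrite pu0 ?mulr0//; exact/negP.
rewrite (@Rintegral_restrict _ _ _ mu setT `[- M, M] (fun x => u t x * phi x))//; last first.
  by move=> x _ xM; rewrite mulrC pu0//; exact/negP.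
have upi : mu.-integrable `[- M, M] (EFin \o (fun x => u t x * phi x)).
  apply: integrableM_smooth => //; apply: continuous_compact_integrable.
    exact: segment_compact.
  exact: continuous_subspaceT.
have gpi : mu.-integrable `[- M, M] (EFin \o (fun x => g x * (phi x * u t x))).
  have := @locally_integrable_itv _ _ (- M) M (locally_integrableM_continuous lg cpu).
  by rewrite (_ : EFin \o _ = EFin \o (fun x => g x * (phi x * u t x)))//; apply/funext => x /=; rewrite mulrC.
apply: le_trans (le_normr_Rintegral _ gpi) _ => //.
rewrite -RintegralZl//; apply: ae_le_Rintegral => //.
- exact: integrable_normr gpi.
- exact: (@integrableZl _ _ _ mu _ (measurable_itv _) K _ upi).
- apply: ae_imp gK => x gK _; rewrite normrM (ger0_norm (mulr_ge0 (phi_ge0 x) (u_ge0 x))).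
  by rewrite (mulrC (phi x)) ler_wpM2r// mulr_ge0.
Qed.

(** A weak solution comes with joint measurability of [ux] only. For u it is extracted from the
    weighted bound on each [0, T'], by multiplying the weight back and exhausting [0, T[. *)
Lemma strong_solution_measurable T (u : R -> R -> R) :
  (forall T' : R, 0 < T' < T -> measurable_fun (`[0, T'] `*` setT)
     (fun z : R * R => bracket z.2 ^- 2 * u z.1 z.2)) ->
  measurable_fun (`[0, T[ `*` setT) (fun z : R * R => u z.1 z.2).
Proof.
move=> H.
have [T0|T0] := leP T 0.
  rewrite set_itv_ge ?set0X; first exact: measurable_fun_set0.
  by rewrite bnd_simp -leNgt.
(* The shift by 2 keeps [b 0] positive, as the hypothesis requires 0 < T'. *)
pose b n := T * (1 - (n.+2%:R)^-1).
have bn n : 0 < b n < T.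
  rewrite /b pmulr_rgt0// subr_gt0 invf_lt1 ?ltr0n// ltr1n /=.
  by rewrite gtr_pMr// ltrBlDr ltrDl invr_gt0 ltr0n.
have -> : `[0, T[ `*` [set: R] = \bigcup_n (`[0, b n] `*` [set: R]).
  apply/seteqP; split => -[t x] /=.
    rewrite in_itv /= => -[/andP[t0 tT] _].
    have Tt : 0 < (T - t) / T by rewrite divr_gt0// subr_gt0.
    pose n := Num.truncn ((T - t) / T)^-1.
    have q : n.+2%:R^-1 <= (T - t) / T.
      rewrite invf_ple ?posrE ?ltr0n//; apply: ltW; apply: lt_trans (truncnS_gt _) _.
      by rewrite ltr_nat.
    exists n => //=; split => //; rewrite in_itv /= t0 /=.
    by move: q; rewrite ler_pdivlMr// /b mulrBr mulr1 [T * _]mulrC lerBrDr -lerBrDl.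
  by move=> [n _ /= []]; rewrite in_itv /= => /andP[t0 tb] _; split => //; rewrite in_itv /= t0 (le_lt_trans tb)//; have /andP[] := bn n.
apply/measurable_fun_bigcup => [n|n]; first exact: measurableX.
have br x : 0 < bracket x by rewrite /bracket sqrtr_gt0 ltr_wpDl// sqr_ge0.
rewrite (_ : (fun z : R * R => u z.1 z.2) =
  (fun z => bracket z.2 ^+ 2 * (bracket z.2 ^- 2 * u z.1 z.2))); last first.
  by apply/funext => z; rewrite mulrA divff ?mul1r// expf_neq0// gt_eqF.
apply: measurable_funM; last exact: H.
apply: measurable_funTS.
rewrite (_ : (fun z : R * R => bracket z.2 ^+ 2) = (fun z => z.2 ^+ 2 + 1)).
  by apply: measurable_funD => //; apply: measurable_funX; exact: measurable_snd.
by apply/funext => z; rewrite /bracket sqr_sqrtr// addr_ge0// sqr_ge0.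
Qed.

Lemma integrable_Linfty_norm b (w : R -> R -> R) :
  measurable_fun (`[0, b] `*` setT) (fun z : R * R => w z.1 z.2) ->
  (\int[mu]_(t in `[0%R, b]) Linfty_norm mu [set: R] (w t) < +oo)%E ->
  mu.-integrable `[0, b] (fun t => Linfty_norm mu setT (w t)).
Proof.
move=> mw woo; apply/integrableP; split; last first.
  by under eq_integral do rewrite gee0_abs ?Linfty_norm_ge0//.
have mQ : measurable (`[0, b] `*` setT : set (R * R)) by exact: measurableX.
(* Extension by zero outside [0, b] leaves the sections at times in [0, b] unchanged. *)
have mG := (measurable_restrictT _ mQ).1 mw.
apply: (eq_measurable_fun (fun t => Linfty_norm mu setT
    (fun x => ((fun z : R * R => w z.1 z.2) \_ (`[0, b] `*` setT)) (t, x)))).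
  move=> t tb; congr (Linfty_norm _ _ _); apply/funext => x; rewrite patchE.
  by rewrite mem_set//=; split => //; rewrite inE in tb.
by apply: measurable_funTS; exact: measurable_Linfty_norm.
Qed.

Lemma strong_solution_comparison T (u0 : R -> R) (u : R -> R -> R) b :
  continuous u0 -> strong_solution T u0 u -> 0 < b < T ->
  exists2 C, 0 < C & forall t, t \in `[0, b] ->
    forall x, u t x <= C * u0 x /\ u0 x <= C * u t x.
Proof.
move=> cu0 [[ux [uC u_ge0 weq]] strong] bT.
have mu_u : measurable_fun (`[0, T[ `*` setT) (fun z : R * R => u z.1 z.2).
  by apply: strong_solution_measurable => T' /strong[[]].
have [_ [uxx [[muxx aeuxx] uxxoo]]] := strong b bT.
have iN := integrable_Linfty_norm muxx uxxoo.
have /andP[b0 b_T] := bT.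
(* The factor 1/2 is that of [flux_bound]. [fine] sends an infinite norm to 0, which can happen only
   on a null set of times. *)
pose n t := 2^-1 * fine (Linfty_norm mu setT (uxx t)).
have ni : mu.-integrable `[0, b] (EFin \o n).
  have := @integrableZl _ _ _ mu _ (measurable_itv _) 2^-1 _ iN.
  apply: le_integrable => //.
    apply/measurable_EFinP; apply: measurable_funM => //.
    by apply: measurableT_comp; [exact: fine_measurable|exact: measurable_int iN].
  move=> s _; rewrite /n /=; have := Linfty_norm_ge0 setT (uxx s).
  by case: (Linfty_norm _ _ _) => [r| |]//= _; rewrite mulr0 normr0 abse_ge0.
(* C is fixed here, before any test function is introduced. *)
have [C C0 HC] := gronwall_chain b0 ni.
exists C => // t tb.
have tT s : s \in `[0, b] -> 0 <= s < T.
  by rewrite in_itv /= => /andP[-> sb]; exact: le_lt_trans sb b_T.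
have cu s : s \in `[0, b] -> continuous (u s).
  by move=> /tT sT; have [_ /(_ s sT)[]] := uC.
have key phi M : 0 < M -> smooth phi -> (forall x, 0 <= phi x) ->
    (forall x, x \notin `[- M, M] -> phi x = 0) ->
    moment u phi t <= C * \int[mu]_x (u0 x * phi x) /\
    \int[mu]_x (u0 x * phi x) <= C * moment u phi t.
  move=> M0 sphi phi_ge0 phi0.
  have evol := moment_evolution uC mu_u weq cu0 sphi phi0 b0 b_T.
  have fi := flux_integrable uC mu_u sphi phi0 b_T.
  have mom0 : moment u phi 0 = \int[mu]_x (u0 x * phi x).
    rewrite evol; last by rewrite in_itv /= lexx ltW.
    by rewrite set_itv1 Rintegral_set1 addr0.
  have mom_ge0 s : s \in `[0, b] -> 0 <= moment u phi s.
    by move=> /tT sT; apply: Rintegral_ge0 => x _; rewrite mulr_ge0// u_ge0.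
  rewrite -mom0; apply: (HC _ (moment_continuous uC mu_u sphi phi0 b_T) mom_ge0 _ _ tb).
  move=> s r K s0 sr rb HK K0.
  have r0 : 0 <= r by exact: le_trans sr.
  have sb : s <= b by exact: le_trans rb.
  have sub x y : 0 <= x -> y <= b -> `[x, y] `<=` `[0, b].
    by move=> x0 yb; apply: subset_itvScc; rewrite bnd_simp.
  have fi' x y : 0 <= x -> y <= b -> mu.-integrable `[x, y] (EFin \o flux u ux phi).
    by move=> x0 yb; apply: integrableS fi => //; exact: sub.
  have ni' : mu.-integrable `[s, r] (EFin \o (fun y => `|n y|)).
    by apply: integrable_normr; apply: integrableS ni => //; exact: sub.
  (* The increment of the moment is the integral of [flux] over [s, r]. *)
  rewrite !evol ?in_itv /= ?s0 ?r0// opprD addrACA subrr add0r.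
  rewrite -Rintegral_itv_split//; last exact: fi'.
  apply: le_trans (le_normr_Rintegral _ (fi' _ _ s0 rb)) _ => //.
  rewrite -RintegralZl//; apply: ae_le_Rintegral => //.
  - by apply: integrable_normr; exact: fi'.
  - exact: (@integrableZl _ _ _ mu _ (measurable_itv _) K _ ni').
  have aeN : {ae mu, forall y, y \in `[0, b] -> Linfty_norm mu setT (uxx y) \is a fin_num}.
    by apply: integrable_ae iN; exact: measurable_itv.
  (* The discarded times are those where [uxx] fails to be the second weak derivative or has
     infinite norm. *)
  apply: ae_imp (ae_and aeuxx aeN) => y [d2 Ny] ysr.
  have yb : y \in `[0, b] by exact: sub ysr.
  have [_ /(_ y (tT y yb))[_ [d1 _]] _] := uC.
  have Nyoo : (Linfty_norm mu setT (uxx y) < +oo)%E.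
    by rewrite ltey_eq; apply/orP; left; exact: Ny.
  have gK : {ae mu, forall x, `|uxx y x| <= fine (Linfty_norm mu setT (uxx y))}.
    by apply: ae_imp (Linfty_norm_lty Nyoo) => x; apply.
  apply: le_trans (flux_bound M0 sphi phi_ge0 phi0 (cu y yb) _ d1 (d2 yb) gK) _.
    by move=> x; exact: u_ge0 (tT y yb).
  rewrite mulrC -/(n y); apply: ler_pM; [exact: mom_ge0| |exact: HK|exact: ler_norm].
  by rewrite mulr_ge0// fine_ge0// Linfty_norm_ge0.
have cC (f : R -> R) : continuous f -> continuous (fun x => C * f x).
  by move=> cf x; apply: cvgM; [exact: cvg_cst|exact: cf].
have [_ /(_ t (tT t tb))[_ [[lut _ _] _]] _] := uC.
(* The inequalities between moments say that the continuous functions C u0 - u(t) and C u(t) - u0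
   have nonnegative integral against every nonnegative test function. *)
move=> x; split; rewrite -subr_ge0.
- apply: (@ge0_test _ (fun x => C * u0 x - u t x)).
    by move=> y; apply: cvgB; [exact: cC|exact: cu].
  move=> phi M M0 sphi phi_ge0 phi0; have [h1 _] := key phi M M0 sphi phi_ge0 phi0.
  have i0 := u0phi_integrable cu0 sphi phi0.
  have it := locally_integrableM_test lut sphi phi0.
  rewrite (@eq_Rintegral _ _ _ mu _ (fun x => C * (u0 x * phi x) - u t x * phi x)); last first.
    by move=> y _; ring.
  rewrite RintegralB//; last exact: (@integrableZl _ _ _ mu _ measurableT C _ i0).
  by rewrite RintegralZl// subr_ge0.
- apply: (@ge0_test _ (fun x => C * u t x - u0 x)).
    by move=> y; apply: cvgB; [apply: cC; exact: cu|exact: cu0].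
  move=> phi M M0 sphi phi_ge0 phi0; have [_ h2] := key phi M M0 sphi phi_ge0 phi0.
  have i0 := u0phi_integrable cu0 sphi phi0.
  have it := locally_integrableM_test lut sphi phi0.
  rewrite (@eq_Rintegral _ _ _ mu _ (fun x => C * (u t x * phi x) - u0 x * phi x)); last first.
    by move=> y _; ring.
  rewrite RintegralB//; last exact: (@integrableZl _ _ _ mu _ measurableT C _ it).
  by rewrite RintegralZl// subr_ge0.
Qed.

End strong_solutions.

Theorem proposition2p7 (R : realType) (T : R) (hT : 0 < T)
    (u0 : R -> R) (hu0 : continuous u0) (u : R -> R -> R)
    (hu : strong_solution T u0 u) (t : R) (ht : 0 <= t < T) :
  [set x : R | u t x = 0] = [set x : R | u0 x = 0].
Proof.
have /andP[t0 tT] := ht.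
(* The midpoint lies beyond t, below T, and is positive even for t = 0. *)
pose b := (t + T) / 2.
have bT : 0 < b < T by rewrite /b; apply/andP; split; lra.
have tb : t \in `[0, b] by rewrite in_itv /= /b; apply/andP; split; lra.
have [C C0 HC] := strong_solution_comparison hu0 hu bT.
(* When one of the two values is 0, one inequality bounds the other value above by 0, and the other
   inequality bounds it below by 0 because C > 0. *)
apply/seteqP; split => x /= ux0; have [h1 h2] := HC t tb x; move: h1 h2; rewrite ux0 mulr0.
- by rewrite pmulr_rge0// => h1 h2; apply/eqP; rewrite eq_le h1 h2.
- by rewrite pmulr_rge0// => h1 h2; apply/eqP; rewrite eq_le h1 h2.
Qed.
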